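(* Suppose that $f:B_1\to\mathbb{R}$ is radial, $f\in H^1(B_1)$, and that $g:[0,|B_1|]\to[0,+\infty)$ is convex with $g(0)=0$ and $g>0$ in $(0,|B_1|]$. Then $$\inf\left\{\frac{\int_{B_1}|\nabla w|^2\,dx}{g(|\{w=f\}|)}:\ w\in H^1_0(B_1),\ |\{w=f\}|\ne0\right\} =\inf\left\{\frac{\int_{B_1}|\nabla w|^2\,dx}{g(|\{w=f\}|)}:\ w\in H^1_0(B_1),\ |\{w=f\}|\ne0,\ w\text{ radial}\right\}.$$
   Context: $B_1$ is the open unit ball of $\mathbb{R}^d$ centered at the origin, $|E|$ is the Lebesgue measure of $E$, and $\{w=f\}=\{x\in B_1:\ w(x)=f(x)\}$. *)

(* Defs.v *)
From HB Require Import structures.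
From mathcomp Require Import all_boot all_order all_algebra.
From mathcomp Require Import all_classical all_reals all_analysis.
Import Order.TTheory GRing.Theory Num.Theory.
Import numFieldNormedType.Exports.

Set Implicit Arguments.
Unset Strict Implicit.
Unset Printing Implicit Defensive.

Local Open Scope classical_set_scope.
Local Open Scope ring_scope.

(* The sigma-algebra on row vectors generated by the coordinates, i.e. the
   Borel sigma-algebra of R^n. *)
Section measurable_row.
Context {R : realType} (n : nat).

Let coords : 'I_n -> 'rV[R]_n -> R := fun i x => x 0 i.

Let row_set0 : g_sigma_preimage coords set0.
Proof. exact: sigma_algebra0. Qed.

Let row_setC A : g_sigma_preimage coords A -> g_sigma_preimage coords (~` A).
Proof. exact: sigma_algebraC. Qed.

Let row_bigcup (F : (set 'rV[R]_n)^nat) :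
  (forall i, g_sigma_preimage coords (F i)) ->
  g_sigma_preimage coords (\bigcup_i (F i)).
Proof. exact: sigma_algebra_bigcup. Qed.

HB.instance Definition _ := @isMeasurable.Build default_measure_display
  'rV[R]_n (g_sigma_preimage coords) row_set0 row_setC row_bigcup.

Lemma measurable_coord (i : 'I_n) :
  measurable_fun [set: 'rV[R]_n] (fun x => x 0 i).
Proof.
move=> _ Y mY; rewrite setTI; apply: sub_sigma_algebra => /=.
rewrite -bigcup_seq/=; exists i => /=; first by rewrite mem_index_enum.
by exists Y => //; rewrite setTI.
Qed.

End measurable_row.

Section lebesgue_row.
Context {R : realType} (n : nat).

Definition cons_row (p : measurableTypeR R * 'rV[R]_n) : 'rV[R]_n.+1 :=
  row_mx (p.1 : R)%:M p.2.

Lemma cons_row0 p : cons_row p 0 ord0 = p.1.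
Proof.
have -> : ord0 = lshift n (ord0 : 'I_1) :> 'I_n.+1 by exact/val_inj.
by rewrite [LHS](row_mxEl _ _ _ ord0) mxE eqxx mulr1n.
Qed.

Lemma cons_rowS p j : cons_row p 0 (lift ord0 j) = p.2 0 j.
Proof.
have -> : lift ord0 j = rshift 1 j :> 'I_n.+1 by exact/val_inj.
exact: row_mxEr.
Qed.

Lemma measurable_cons_row : measurable_fun [set: _] cons_row.
Proof.
move=> _ Y mY; rewrite setTI.
suff : g_sigma_preimage (fun (i : 'I_n.+1) (p : measurableTypeR R * 'rV[R]_n) =>
    cons_row p 0 i : R) `<=` measurable.
  apply; rewrite (_ : (fun _ => _) =
    (fun i => (fun x : 'rV[R]_n.+1 => x 0 i) \o cons_row)) //.
  by rewrite g_sigma_preimage_comp; exists Y => //; rewrite setTI.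
apply: smallest_sub; first exact: sigma_algebra_measurable.
rewrite -bigcup_seq => A [i _] [C mC <-].
suff : measurable_fun [set: _] (fun p => cons_row p 0 i : R) by exact.
case: (unliftP ord0 i) => [j|] ->.
  rewrite (_ : (fun _ => _) = (fun x : 'rV[R]_n => x 0 j) \o snd).
    exact: measurableT_comp (measurable_coord j) measurable_snd.
  by apply/funext => p; rewrite cons_rowS.
rewrite (_ : (fun _ => _) = fst); first exact: measurable_fst.
by apply/funext => p; rewrite cons_row0.
Qed.

Let mcons A : measurable A -> measurable (cons_row @^-1` A).
Proof. by move=> mA; rewrite -[X in measurable X]setTI; exact: measurable_cons_row. Qed.

Variable mu : {measure set 'rV[R]_n -> \bar R}.

Definition leb_cons : set 'rV[R]_n.+1 -> \bar R :=
  pushforward (lebesgue_measure \x^ mu)%E cons_row.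

Let leb_cons0 : leb_cons set0 = 0%E.
Proof. by rewrite /leb_cons /pushforward preimage_set0 measure0. Qed.

Let leb_cons_ge0 A : (0 <= leb_cons A)%E.
Proof. by rewrite /leb_cons /pushforward; exact: measure_ge0. Qed.

Let leb_cons_sigma_additive : semi_sigma_additive leb_cons.
Proof.
move=> F mF tF mUF; rewrite /leb_cons /pushforward preimage_bigcup.
apply: measure_semi_sigma_additive.
- by move=> k; exact: mcons.
- apply/trivIsetP => /= i j _ _ ij; rewrite -preimage_setI.
  by move/trivIsetP : tF => /(_ _ _ _ _ ij) ->//; rewrite preimage_set0.
- by rewrite -preimage_bigcup; exact: mcons.
Qed.

HB.instance Definition _ := isMeasure.Build _ _ _ leb_cons
  leb_cons0 leb_cons_ge0 leb_cons_sigma_additive.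

End lebesgue_row.

(* Lebesgue measure on R^n, as an iterated product of the one-dimensional
   Lebesgue measure; on the one-point space R^0 it is the Dirac mass. *)
Fixpoint leb {R : realType} (n : nat) : {measure set 'rV[R]_n -> \bar R} :=
  match n with
  | 0 => \d_(0 : 'rV[R]_0)
  | m.+1 => leb_cons (leb m)
  end.

Lemma leb_box (R : realType) n (A : 'I_n -> set R) :
  (forall i, measurable (A i)) ->
  leb n [set x | forall i, A i (x 0 i)] =
  (\prod_(i < n) lebesgue_measure (A i))%E.
Proof.
elim: n A => [|n IHn] A mA.
  rewrite big_ord0 /= diracE mem_set// => -[]//.
rewrite big_ord_recl -IHn// /leb -/leb /= /leb_cons /pushforward.
have mA' : measurable [set x : 'rV[R]_n | forall i, A (lift ord0 i) (x 0 i)].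
  rewrite (_ : mkset _ = \bigcap_(i in [set: 'I_n])
    ((fun x : 'rV[R]_n => x 0 i) @^-1` A (lift ord0 i))).
    apply: fin_bigcap_measurable => // i _; rewrite -[X in measurable X]setTI.
    exact: measurable_coord.
  by apply/seteqP; split=> [x h i _|x h i]; exact: h.
rewrite -[RHS]product_measure2E//; last exact: mA.
congr ((_ \x^ _)%E _); apply/seteqP; split=> -[a x] /=.
  move=> h; split=> [|i]; first by have := h ord0; rewrite cons_row0.
  by have := h (lift ord0 i); rewrite cons_rowS.
move=> [h0 h1] i; case: (unliftP ord0 i) => [j|] ->.
  by rewrite cons_rowS; exact: h1.
by rewrite cons_row0.
Qed.

(* The norm of 'rV[R]_n in the library is the sup norm. *)
Definition enorm {R : realType} n (x : 'rV[R]_n) : R :=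
  Num.sqrt (\sum_(i < n) x 0 i ^+ 2).

Definition unit_ball {R : realType} (n : nat) : set 'rV[R]_n :=
  [set x | enorm x < 1].
Arguments unit_ball {R}.

Section sobolev.
Context {R : realType} (n : nat).
Local Notation B := (unit_ball n : set 'rV[R]_n).
Implicit Types (u v phi : 'rV[R]_n -> R) (G : 'rV[R]_n -> 'rV[R]_n).

(* Elements of L^2 and H^1 are represented by Borel functions on R^n, of which
   only the restriction to the ball matters. *)
Definition square_integrable u :=
  measurable_fun B u /\ (leb n).-integrable B (fun x => (u x ^+ 2)%:E).

Definition partial (i : 'I_n) phi : 'rV[R]_n -> R :=
  fun x => 'D_(delta_mx 0 i) phi x.

Definition gradient phi : 'rV[R]_n -> 'rV[R]_n :=
  fun x => \row_i partial i phi x.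

Definition smooth phi :=
  forall (s : seq 'I_n) x, differentiable (foldr partial phi s) x.

Definition test_function phi :=
  let supp := closure [set x | phi x != 0] in
  [/\ smooth phi, compact supp & supp `<=` B].

Definition weak_gradient u G := forall phi (i : 'I_n), test_function phi ->
  \int[leb n]_(x in B) (u x * partial i phi x) =
  - \int[leb n]_(x in B) (G x 0 i * phi x).

(* u belongs to H^1(B_1), with weak gradient G. *)
Definition H1_grad u G :=
  [/\ square_integrable u,
      forall i, square_integrable (fun x => G x 0 i) &
      weak_gradient u G].

Definition H1 u := exists G, H1_grad u G.

(* u belongs to H^1_0(B_1), the closure of the test functions in H^1(B_1), with
   weak gradient G. *)
Definition H10_grad u G :=
  H1_grad u G /\
  exists phi : nat -> 'rV[R]_n -> R, (forall k, test_function (phi k)) /\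
    (fun k => \int[leb n]_(x in B)
      ((u x - phi k x) ^+ 2 + enorm (G x - gradient (phi k) x) ^+ 2)%:E)%E
      @ \oo --> 0%E.

(* Radiality of a class of functions modulo equality almost everywhere. *)
Definition radial u := exists h : R -> R,
  {ae leb n, forall x, B x -> u x = h (enorm x)}.

Definition contact_set u v : set 'rV[R]_n := [set x | B x /\ u x = v x].

(* A weak gradient is unique up to a null set, so the energy of w does not
   depend on the choice of G. *)
Definition quotients (f : 'rV[R]_n -> R) (g : R -> R)
    (P : ('rV[R]_n -> R) -> Prop) : set (\bar R) :=
  [set q | exists w G, [/\ H10_grad w G, P w,
     leb n (contact_set w f) != 0%E &
     q = (\int[leb n]_(x in B) (enorm (G x) ^+ 2)%:E /
          (g (fine (leb n (contact_set w f))))%:E)%E]].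

End sobolev.

(* Main.v *)
Require Import Defs.
From HB Require Import structures.
From mathcomp Require Import all_boot all_order all_algebra.
From mathcomp Require Import all_classical all_reals all_analysis measurable_realfun.
From mathcomp Require Import ring lra.
Import Order.TTheory GRing.Theory Num.Theory.
Import numFieldNormedType.Exports.

(** Replace w by the radial functions w_y that agree with w on the ray through a
    point y of the ball, w_y(x) = w(|x| y / |y|). Let E(y) be the energy of the
    radial part of the gradient of w along this ray, and M(y) the measure of the
    contact set of w_y with f. In polar coordinates, the mean of E over the ball
    is at most the energy e of w, since the radial part of the gradient is no
    longer than the gradient, and the mean of M is the measure t0 of the contact
    set of w, since f is radial. By the inequality of Jensen, the mean of g(M) is
    at least g(t0). So some y with M(y) > 0 satisfies E(y) <= (e / g(t0)) g(M(y)),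
    and the quotient of w_y is at most the quotient of w.

    Polar coordinates are used without a surface measure on the sphere: the
    direction is that of a second point y, uniform in the ball and independent of
    x. Under the uniform measure of the ball, norm and direction are independent,
    because Lebesgue measure scales under dilations (leb_affine); hence the point
    with the norm of x and the direction of y is again uniform
    (polar_average, polar_average_ball).

    That w_y belongs to H^1_0 for almost every y (ae_slice_H10) is checked on
    approximations. Test functions phi_k converging to w converge to it on almost
    every ray, along a subsequence that depends on the ray. The restriction of
    phi_k to a ray is a smooth profile p, and p(|x|) is not smooth at the origin,
    but it is the limit of the test functions p(sqrt(|x|^2 + eps^2))
    (profile_approx). A limit of test functions in the sense of H^1 has a weak
    gradient (H10_approx), since test functions may be integrated by parts
    (integration_by_parts).

    The direction is chosen in jensen_selection, which uses a supporting line of g at t0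
    (supporting_line); at the end point |B_1|, where such a line may not exist,
    M equals t0 almost everywhere. *)

Set Implicit Arguments.
Unset Strict Implicit.
Unset Printing Implicit Defensive.

Local Open Scope classical_set_scope.
Local Open Scope ring_scope.

(** * Borel sets and Lebesgue measure on rows *)

(** The image of a measure, carrying the proof that the map is measurable so
    that the measure structure does not have to be inferred. *)
Definition image_measure d d' (T : measurableType d) (T' : measurableType d')
    (R : realType) (m : {measure set T -> \bar R}) (f : T -> T')
    (mf : measurable_fun [set: T] f) : {measure set T' -> \bar R} :=
  measure_function_pushforward__canonical__measure_function_Measure m mf.

Section measurable_rows.
Context {R : realType} {n : nat}.
Local Notation V := 'rV[R]_n.

Lemma coord_le_norm (x : V) i : `|x 0 i| <= `|x|.
Proof.
rewrite [leRHS]/Num.norm/= mx_normrE; apply/bigmax_geP; right => /=.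
by exists (0, i).
Qed.

Lemma measurable_box (A : 'I_n -> set R) : (forall i, measurable (A i)) ->
  measurable [set x : V | forall i, A i (x 0 i)].
Proof.
move=> mA; rewrite (_ : mkset _ = \bigcap_(i in [set: 'I_n])
    ((fun x : V => x 0 i) @^-1` A i)).
  apply: fin_bigcap_measurable => // i _; rewrite -[X in measurable X]setTI.
  exact: measurable_coord.
by apply/seteqP; split=> [x h i _|x h i]; exact: h.
Qed.

Lemma measurable_row_fun d (T : measurableType d) (D : set T) (f : T -> V) :
  measurable D ->
  (forall i, measurable_fun D (fun t => f t 0 i)) -> measurable_fun D f.
Proof.
move=> mD mf; apply: (@measurability _ _ _ _ _ _
  [set A | exists (i : 'I_n) (C : set R), measurable C /\
     A = (fun x : V => x 0 i) @^-1` C]).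
  apply/seteqP; split=> [A|].
    apply: smallest_sub; first exact: smallest_sigma_algebra.
    rewrite -bigcup_seq => B [i _] [C mC <-]; apply: sub_sigma_algebra.
    by exists i, C; rewrite setTI.
  apply: smallest_sub; first exact: sigma_algebra_measurable.
  move=> _ [i [C [mC ->]]]; rewrite -[X in measurable X]setTI.
  exact: measurable_coord.
move=> _ [_ [i [C [mC ->]]] <-]; rewrite -comp_preimage.
exact: mf.
Qed.

(** The Borel sets are generated by the coordinates: a ball of the sup norm is
    a box, and an open set is the union of the boxes with rational centre and
    width that it contains. *)
Lemma open_measurable_row (U : set V) : open U -> measurable U.
Proof.
move=> oU.
pose box (p : 'rV[rat]_n * nat) : set V :=
  [set x | forall i, `]ratr (p.1 0 i) - p.2.+1%:R^-1,
                       ratr (p.1 0 i) + p.2.+1%:R^-1[%classic (x 0 i)].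
have -> : U = \bigcup_p (if `[< box p `<=` U >] then box p else set0).
  apply/seteqP; split=> [x Ux|x [p _]]; last first.
    by case: asboolP => // sub; exact: sub.
  have /nbhs_ballP[e /= e0 xeU] := open_nbhs_nbhs (conj oU Ux).
  have [k ke] : exists k, k.+1%:R^-1 < e / 2.
    have [k] := near_infty_natSinv_lt (PosNum (divr_gt0 e0 (ltr0Sn R 1))) => /=.
    by move=> _ /(_ k (leqnn _)); exists k.
  have k0 : (0 : R) < k.+1%:R^-1 by rewrite invr_gt0.
  have /choice[q xq] i : exists q : rat,
      ratr q \in `]x 0 i - k.+1%:R^-1, x 0 i + k.+1%:R^-1[.
    by apply: rat_in_itvoo; rewrite ltrD2l gtrN.
  exists (\row_i q i, k) => //.
  have xb : box (\row_i q i, k) x.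
    move=> i /=; rewrite mxE; have := xq i; rewrite !in_itv /=.
    move: (k.+1%:R^-1) (ratr _) => r s /andP[? ?]; apply/andP; split; lra.
  case: asboolP => //; case=> y yb; apply: xeU; split=> // i j.
  rewrite (ord1 i); have := yb j; rewrite /= mxE => {}yb; have {}xq := xq j.
  rewrite /ball/= ltr_norml; move: ke yb xq; rewrite !in_itv/=.
  move: (k.+1%:R^-1) (ratr _) => r s ? /andP[? ?] /andP[? ?].
  apply/andP; split; lra.
apply: (@countable_bigcupT_measurable _ _ ('rV[rat]_n * nat)%type) => [|p].
  exact: countableP.
case: asboolP => // _.
by apply: (measurable_box (A := fun i => `]ratr (p.1 0 i) - p.2.+1%:R^-1,
  ratr (p.1 0 i) + p.2.+1%:R^-1[%classic)) => i; exact: measurable_itv.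
Qed.

Lemma continuous_measurable_row (f : V -> R) :
  continuous f -> measurable_fun [set: V] f.
Proof.
move=> cf; apply: (measurability _ (RGenOpens.measurableE R)).
move=> _ [_ [a [b ->]] <-]; rewrite setTI; apply: open_measurable_row.
by move/continuousP : cf; apply; exact: interval_open.
Qed.

End measurable_rows.

Section lebesgue_affine.
Context {R : realType}.

Local Notation mu1 := (@lebesgue_measure R).

Lemma leb1_affine (s a : R) (A : set R) : 0 < s -> measurable A ->
  mu1 A = (s%:E * mu1 ((fun x => s * x + a)%R @^-1` A))%E.
Proof.
move=> s0 mA.
pose T (x : measurableTypeR R) : measurableTypeR R := s * x + a.
have mT : measurable_fun setT T.
  by apply: measurable_funD => //; exact: measurable_funM.
have s0' : s != 0 by rewrite gt_eqF.
pose m := mscale (NngNum (ltW s0)) (image_measure mu1 mT).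
rewrite -[RHS]/(m A).
apply: (lebesgue_measure_unique (mu := m)) => // _ [[x y] _ <-] /=.
rewrite /m /mscale /= /pushforward /= /T.
rewrite (_ : _ @^-1` _ = `](x - a) / s, (y - a) / s]%classic).
  rewrite !lebesgue_measure_itv /= !lte_fin ltr_pM2r ?invr_gt0// ltrBlDr subrK.
  case: ifPn => [xy|_]; last by rewrite mule0.
  by rewrite -!EFinD -EFinM; congr EFin; field.
apply/seteqP; split=> z /=; rewrite !in_itv/= ltr_pdivrMr// ler_pdivlMr//.
  by move=> /andP[? ?]; apply/andP; split; lra.
by move=> /andP[? ?]; apply/andP; split; lra.
Qed.

Context {n : nat}.
Local Notation V := 'rV[R]_n.

Definition cube (r : R) : set V := [set x | forall i, `[- r, r]%classic (x 0 i)].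

Lemma measurable_cube r : measurable (cube r).
Proof. exact: (measurable_box (A := fun=> `[- r, r]%classic)). Qed.

Lemma leb_cube_lty r : (leb n (cube r) < +oo)%E.
Proof.
rewrite (@leb_box _ _ (fun=> `[- r, r]%classic))//.
suff : (\prod_(i < n) mu1 `[(- r)%R, r%R]%classic)%E \is a fin_num.
  by rewrite fin_numElt => /andP[].
by elim/big_rec : _ => // i x _ xfin; rewrite fin_numM// lebesgue_measure_itv/=; case: ifP.
Qed.

(** Measurable boxes form a generating pi-system that contains the cubes
    exhausting the space. *)
Lemma leb_unique (m : {measure set V -> \bar R}) :
  (forall A : 'I_n -> set R, (forall i, measurable (A i)) ->
     m [set x | forall i, A i (x 0 i)] = (\prod_(i < n) mu1 (A i))%E) ->
  forall A, measurable A -> leb n A = m A.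
Proof.
move=> mE A mA.
pose G := [set B : set V | exists A : 'I_n -> set R,
  (forall i, measurable (A i)) /\ B = [set x | forall i, A i (x 0 i)]].
pose g (k : nat) := cube k%:R.
apply: (measure_unique G g) => //.
- apply/seteqP; split=> [B|].
    apply: smallest_sub; first exact: smallest_sigma_algebra.
    rewrite -bigcup_seq => C [i _] [D mD <-]; apply: sub_sigma_algebra.
    rewrite setTI; exists (fun j => if j == i then D else setT); split.
      by move=> j; case: ifP.
    apply/seteqP; split=> x /= => [xD j|/(_ i)]; last by rewrite eqxx.
    by case: eqP => // ->.
  apply: smallest_sub; first exact: sigma_algebra_measurable.
  by move=> _ [B [mB ->]]; exact: measurable_box.
- move=> _ _ [B [mB ->]] [C [mC ->]]; exists (fun i => B i `&` C i); split.
    by move=> i; exact: measurableI.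
  by apply/seteqP; split=> x /= => [[xB xC] i|xBC]; split=> // i; have [] := xBC i.
- by move=> k; exists (fun=> `[- k%:R, k%:R]%classic).
- apply/seteqP; split=> // x _.
  have [k kx] : exists k : nat, forall i, `|(x : V) 0 i| <= k%:R.
    exists (Num.bound `|x : V|) => i; apply: le_trans (coord_le_norm _ _) _.
    by apply: ltW; exact: archi_boundP.
  by exists k => // i /=; rewrite in_itv/= -ler_norml.
- by move=> _ [B [mB ->]]; rewrite mE// leb_box.
- by move=> k; exact: leb_cube_lty.
Qed.

(** The behaviour under dilations gives polar coordinates, and invariance under
    translations gives integration by parts. *)
Lemma leb_affine (s : R) (a : V) (A : set V) : 0 < s -> measurable A ->
  leb n A = ((s ^+ n)%:E * leb n ((fun x => s *: x + a)%R @^-1` A))%E.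
Proof.
move=> s0 mA; pose T (x : V) := s *: x + a.
have mT : measurable_fun [set: V] T.
  apply: measurable_row_fun => // i.
  rewrite (_ : (fun _ => _) = fun x : V => s * x 0 i + a 0 i); last first.
    by apply/funext => x; rewrite !mxE.
  by apply: measurable_funD => //; apply: measurable_funM => //; exact: measurable_coord.
pose m := mscale (NngNum (exprn_ge0 n (ltW s0))) (image_measure (leb n) mT).
rewrite -[RHS]/(m A); apply: leb_unique => // B mB.
transitivity ((s ^+ n)%:E * leb n [set x : V | forall i,
    ((fun y => s * y + a ord0 i)%R @^-1` (B i)) (x ord0 i)])%E.
  rewrite -[LHS]/((s ^+ n)%:E * leb n (T @^-1` _))%E; congr (_ * leb n _)%E.
  by apply/seteqP; split=> x /= + i => /(_ i); rewrite !mxE.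
have mTi i : measurable ((fun y => s * y + a 0 i) @^-1` (B i)).
  rewrite -[X in measurable X]setTI.
  suff : measurable_fun setT (fun y : R => s * y + a 0 i) by apply.
  by apply: measurable_funD => //; exact: measurable_funM.
rewrite (leb_box (A := fun i => (fun y => s * y + a ord0 i) @^-1` (B i)))//.
under [RHS]eq_bigr => i _ do rewrite (leb1_affine (a 0 i) s0 (mB i)).
have -> : s ^+ n = \prod_(i < n) s by rewrite prodr_const card_ord.
elim: (index_enum _) => [|j e IH].
  by rewrite !big_nil mul1e.
by rewrite !big_cons EFinM muleACA IH.
Qed.

End lebesgue_affine.

(** * The Euclidean norm and directions *)

Lemma cvg_sumr (R : realType) (T I : Type) (F : set_system T) (FF : Filter F)
    (f : I -> T -> R) (l : I -> R) (s : seq I) :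
  (forall i, f i x @[x --> F] --> l i) ->
  (\sum_(i <- s) f i x) @[x --> F] --> \sum_(i <- s) l i.
Proof.
move=> fl; elim: s => [|i s IH].
  rewrite big_nil; have -> : (fun x => \sum_(i <- [::]) f i x) = cst 0.
    by apply/funext => x; rewrite big_nil.
  exact: cvg_cst.
rewrite big_cons.
have -> : (fun x => \sum_(j <- i :: s) f j x) = (fun x => f i x + \sum_(j <- s) f j x).
  by apply/funext => x; rewrite big_cons.
exact: cvgD.
Qed.

Lemma measurable_inv (R : realType) : measurable_fun [set: R] (@GRing.inv R).
Proof.
have -> : [set: R] = ~` [set 0] `|` [set 0] by rewrite setUC setUv.
apply/measurable_funU; [exact: measurableC|exact: measurable_set1|split].
  apply: open_continuous_measurable_fun; first by apply: closed_openC; exact: closed_eq.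
  by move=> x; rewrite inE/= => /eqP; exact: inv_continuous.
exact: measurable_fun_set1.
Qed.

Section euclidean_norm.
Context {R : realType} {n : nat}.
Local Notation V := 'rV[R]_n.
Local Notation B := (unit_ball n : set V).
Implicit Types x y : V.

Lemma sumsq_ge0 x : 0 <= \sum_(i < n) x 0 i ^+ 2.
Proof. by apply: sumr_ge0 => i _; exact: sqr_ge0. Qed.

Lemma enorm_ge0 x : 0 <= enorm x. Proof. exact: sqrtr_ge0. Qed.

Lemma sqr_enorm x : enorm x ^+ 2 = \sum_(i < n) x 0 i ^+ 2.
Proof. by rewrite sqr_sqrtr// sumsq_ge0. Qed.

Lemma enormZ (a : R) x : enorm (a *: x) = `|a| * enorm x.
Proof.
rewrite /enorm -sqrtr_sqr -sqrtrM ?sqr_ge0// mulr_sumr; congr Num.sqrt.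
by apply: eq_bigr => i _; rewrite mxE exprMn.
Qed.

Lemma coord_le_enorm x i : `|x 0 i| <= enorm x.
Proof.
rewrite -[leLHS]sqrtr_sqr ler_wsqrtr// (bigD1 i)//= lerDl.
by apply: sumr_ge0 => j _; exact: sqr_ge0.
Qed.

Lemma enorm_eq0 x : enorm x = 0 -> x = 0.
Proof.
move=> x0; apply/rowP => i; rewrite mxE; apply/eqP.
by rewrite -normr_le0 (le_trans (coord_le_enorm _ _))// x0.
Qed.

Lemma enorm0 : enorm (0 : V) = 0.
Proof. by rewrite -(scale0r (0 : V)) enormZ normr0 mul0r. Qed.

Lemma continuous_enorm : continuous (@enorm R n).
Proof.
move=> x; apply: (@continuous_comp _ _ _ _ Num.sqrt); last exact: sqrt_continuous.
apply: (cvg_sumr (nbhs_filter x)) => i.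
have c2 : continuous ((fun a : R => a ^+ 2) \o (fun y : V => y 0 i)).
  move=> y; apply: continuous_comp; first exact: coord_continuous.
  exact: exprn_continuous.
exact: c2.
Qed.

Lemma measurable_enorm : measurable_fun [set: V] (@enorm R n).
Proof. by apply: continuous_measurable_row; exact: continuous_enorm. Qed.

Lemma measurable_unit_ball : measurable B.
Proof.
rewrite (_ : B = @enorm R n @^-1` `]-oo, 1[%classic).
  by rewrite -[X in measurable X]setTI; exact: measurable_enorm.
by apply/seteqP; split=> x /=; rewrite in_itv.
Qed.

Lemma unit_ball_cube : B `<=` cube 1.
Proof.
move=> x /= Bx i /=; rewrite in_itv/= -ler_norml.
exact: le_trans (coord_le_enorm _ _) (ltW Bx).
Qed.

Lemma leb_ball_lty : (leb n B < +oo)%E.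
Proof.
apply: le_lt_trans (@leb_cube_lty R n 1).
by apply: le_measure; rewrite ?inE; [exact: measurable_unit_ball|
  exact: measurable_cube|exact: unit_ball_cube].
Qed.

Lemma leb_ball_fin_num : leb n B \is a fin_num.
Proof. by rewrite ge0_fin_numE ?measure_ge0// leb_ball_lty. Qed.

Lemma leb_origin : (0 < n)%N -> leb n [set (0 : V)] = 0%E.
Proof.
move=> n0; rewrite (_ : [set 0] = [set x : V | forall i, [set 0] (x 0 i)]).
  rewrite (@leb_box _ _ (fun=> [set 0]))// (bigD1 (Ordinal n0))//= lebesgue_measure_set1.
  by rewrite mul0e.
apply/seteqP; split=> x /= => [->|h]; first by move=> i; rewrite mxE.
by apply/rowP => i; rewrite h mxE.
Qed.

(** The radial projection to the unit sphere, with value 0 at the origin. *)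
Definition dir x : V := (enorm x)^-1 *: x.

Lemma enorm_dir x : x != 0 -> enorm (dir x) = 1.
Proof.
move=> x0; rewrite enormZ ger0_norm ?invr_ge0 ?enorm_ge0// mulVf//.
by apply: contra_neq x0; exact: enorm_eq0.
Qed.

Lemma enorm_dir_le1 x : enorm (dir x) <= 1.
Proof.
have [->|/enorm_dir->//] := eqVneq x 0.
by rewrite /dir scaler0 enorm0.
Qed.

Lemma enorm_dirK x : enorm x *: dir x = x.
Proof.
have [->|x0] := eqVneq x 0; first by rewrite /dir !scaler0.
rewrite scalerA divff ?scale1r//.
by apply: contra_neq x0; exact: enorm_eq0.
Qed.

Lemma dirZ (a : R) x : 0 < a -> dir (a *: x) = dir x.
Proof.
move=> a0; rewrite /dir enormZ gtr0_norm// scalerA invfM mulrAC mulVf ?mul1r//.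
by rewrite gt_eqF.
Qed.

Lemma measurable_dir : measurable_fun [set: V] dir.
Proof.
apply: measurable_row_fun => // i.
rewrite (_ : (fun _ => _) = fun x : V => (enorm x)^-1 * x 0 i); last first.
  by apply/funext => x; rewrite mxE.
apply: measurable_funM; last exact: measurable_coord.
have mV : measurable_fun setT (fun a : R => a^-1) by exact: measurable_inv.
exact: measurableT_comp mV measurable_enorm.
Qed.

Lemma measurable_scale_row d (T : measurableType d) (D : set T) (r : T -> R) (u : T -> V) :
  measurable D -> measurable_fun D r -> measurable_fun D u ->
  measurable_fun D (fun t => r t *: u t).
Proof.
move=> mD mr mu; apply: measurable_row_fun => // i.
rewrite (_ : (fun _ => _) = fun t => r t * u t 0 i); last first.
  by apply/funext => x; rewrite mxE.
apply: measurable_funM => //.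
exact: measurableT_comp (measurable_coord i) mu.
Qed.

End euclidean_norm.

(** * Polar coordinates *)

Section polar.
Context {R : realType} {n : nat}.
Local Notation V := 'rV[R]_n.
Local Notation B := (unit_ball n : set V).

(** Lebesgue measure on the ball, as a finite measure on the whole space, so that
    its square is covered by the theorem of Tonelli. *)
Definition ball_measure : {finite_measure set V -> \bar R} :=
  mfrestr measurable_unit_ball (@leb_ball_lty R n).

Lemma ge0_integral_ball_measure (F : V -> \bar R) :
  measurable_fun [set: V] F -> (forall x, 0 <= F x)%E ->
  (\int[ball_measure]_x F x = \int[leb n]_(x in B) F x)%E.
Proof.
move=> mF F0.
rewrite (@ge0_negligible_integral _ _ _ ball_measure setT (~` B))//; first last.
- by rewrite -[LHS]/(leb n (~` B `&` B)) setICl measure0.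
- by apply: measurableC; exact: measurable_unit_ball.
rewrite setDE setCK setTI; apply: eq_measure_integral => A mA AB.
by rewrite -[LHS]/(leb n (A `&` B)) (setIidl AB).
Qed.

Let mpart (C : set V) (s : R) : \bar R := leb n [set x : V | enorm x < s /\ C (dir x)].

(* The set is the dilation by s of its part in the unit ball. *)
Let mpart_scale C s : measurable C -> 0 < s -> mpart C s = ((s ^+ n)%:E * mpart C 1%R)%E.
Proof.
move=> mC s0; rewrite /mpart (leb_affine 0 s0); last first.
  rewrite (_ : mkset _ = @enorm R n @^-1` `]-oo, s[%classic `&` dir @^-1` C).
    apply: measurableI; rewrite -[X in measurable X]setTI.
      exact: measurable_enorm.
    exact: measurable_dir.
  by apply/seteqP; split=> x /=; rewrite in_itv.
congr (_ * _)%E; apply: (congr1 (leb n)); apply/seteqP; split=> x /=;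
  by rewrite addr0 enormZ gtr0_norm// dirZ// gtr_pMr.
Qed.

Let mpart_ball C s :
  ball_measure (@enorm R n @^-1` `]-oo, s[ `&` dir @^-1` C) = mpart C (Num.min s 1).
Proof.
apply: (congr1 (leb n)); apply/seteqP; split=> x /=; rewrite lt_min in_itv/=.
  by move=> [[-> dC]] ->.
by move=> [/andP[-> xB] dC].
Qed.

Let mpart_le0 C s : s <= 0 -> mpart C s = 0%E.
Proof.
move=> s0; rewrite /mpart (_ : mkset _ = set0) ?measure0//.
apply/seteqP; split=> // x /= [xs _].
by have := le_lt_trans (enorm_ge0 x) xs; rewrite ltNge s0.
Qed.

(** Under the uniform measure of the ball, the norm and the direction are
    independent: on rays the first one is governed by dilations, which do not
    change the direction. *)
Let polar_indep A C : measurable A -> measurable C ->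
  (leb n B * ball_measure (@enorm R n @^-1` A `&` dir @^-1` C) =
   ball_measure (@enorm R n @^-1` A) * ball_measure (dir @^-1` C))%E.
Proof.
move=> mA mC.
have mdC : measurable (dir @^-1` C : set V).
  by rewrite -[X in measurable X]setTI; exact: measurable_dir.
have fdC : ball_measure (dir @^-1` C) \is a fin_num by exact: fin_num_measure.
have fB : leb n B \is a fin_num := leb_ball_fin_num.
have c0 : 0 <= fine (ball_measure (dir @^-1` C)) by rewrite fine_ge0.
have b0 : 0 <= fine (leb n B) by rewrite fine_ge0.
have me := @measurable_enorm R n.
pose m1 : {measure set R -> \bar R} :=
  mscale (NngNum b0) (image_measure (mrestr ball_measure mdC) me).
pose m2 : {measure set R -> \bar R} :=
  mscale (NngNum c0) (image_measure ball_measure me).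
suff : m1 A = m2 A.
  rewrite -[m1 A]/((fine (leb n B))%:E *
    ball_measure (@enorm R n @^-1` A `&` dir @^-1` C))%E.
  rewrite -[m2 A]/((fine (ball_measure (dir @^-1` C)))%:E *
    ball_measure (@enorm R n @^-1` A))%E.
  by rewrite !fineK// [RHS]muleC.
apply: (measure_unique (@RGenInftyO.G R) (fun k : nat => `]-oo, k%:R[%classic)).
- exact: RGenInftyO.measurableE.
- move=> _ _ [x ->] [y ->]; exists (Num.min x y); apply/seteqP; split=> z /=;
    by rewrite !in_itv/= lt_min => /andP.
- by move=> k; exists k%:R.
- apply/seteqP; split=> // x _; exists (Num.bound `|x|) => //=; rewrite in_itv/=.
  by apply: le_lt_trans (ler_norm x) _; exact: archi_boundP.
- move=> _ [s ->]; rewrite -[LHS]/((fine (leb n B))%:E *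
    ball_measure (@enorm R n @^-1` `]-oo, s[ `&` dir @^-1` C))%E.
  rewrite -[RHS]/((fine (ball_measure (dir @^-1` C)))%:E *
    ball_measure (@enorm R n @^-1` `]-oo, s[))%E !fineK//.
  have -> : leb n B = mpart setT 1.
    by apply: (congr1 (leb n)); apply/seteqP; split=> x //= -[].
  have -> : ball_measure (dir @^-1` C) = mpart C 1.
    by apply: (congr1 (leb n)); apply/seteqP; split=> x //= -[].
  have -> : ball_measure (@enorm R n @^-1` `]-oo, s[) = mpart setT (Num.min s 1).
    by rewrite -mpart_ball preimage_setT setIT.
  rewrite mpart_ball; have [t0|t0] := leP (Num.min s 1) 0.
    by rewrite !(mpart_le0 _ t0) !mule0.
  by rewrite !(mpart_scale _ t0)// muleCA [RHS]muleCA [X in (_ * X)%E]muleC.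
- move=> k; rewrite -ge0_fin_numE ?measure_ge0//.
  rewrite -[X in X \is a _]/((fine (leb n B))%:E *
    ball_measure (@enorm R n @^-1` `]-oo, k%:R[ `&` dir @^-1` C))%E.
  apply: fin_numM => //; apply: fin_num_measure; apply: measurableI => //.
  by rewrite -[X in measurable X]setTI; exact: measurable_enorm.
- exact: mA.
Qed.

(* Independence, on rectangles, determines the joint law of norm and direction. *)
Let polar_product : forall E : set (R * V), measurable E ->
  (ball_measure \x ball_measure)%E ((fun p : V * V => (enorm p.1, dir p.2)) @^-1` E) =
  (leb n B * ball_measure ((fun x : V => (enorm x, dir x)) @^-1` E))%E.
Proof.
have mS : measurable_fun [set: V * V] (fun p : V * V => (enorm p.1, dir p.2)).
  apply: measurable_fun_pair; apply: measurableT_comp => //.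
    exact: measurable_enorm.
  exact: measurable_dir.
have mT : measurable_fun [set: V] (fun x : V => (enorm x, dir x)).
  apply: measurable_fun_pair; [exact: measurable_enorm|exact: measurable_dir].
have fB : leb n B \is a fin_num := leb_ball_fin_num.
have b0 : 0 <= fine (leb n B) by rewrite fine_ge0.
pose m1 : {measure set (R * V) -> \bar R} :=
  image_measure (ball_measure \x ball_measure)%E mS.
pose m2 : {measure set (R * V) -> \bar R} :=
  mscale (NngNum b0) (image_measure ball_measure mT).
suff m12 E : measurable E -> m1 E = m2 E.
  move=> E /m12; rewrite -[m2 E]/((fine (leb n B))%:E *
    ball_measure ((fun x : V => (enorm x, dir x)) @^-1` E))%E.
  by rewrite fineK// => <-.
pose C : set (set (R * V)) :=
  [set C | exists A, measurable A /\ exists D, measurable D /\ C = A `*` D].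
apply: (measure_unique C (fun=> setT)).
- rewrite measurable_prod_measurableType //; congr (<<s _ >>).
  rewrite predeqE; split => [[A mA [D mD <-]]|[A [mA [D [mD ->]]]]].
    by exists A; split => //; exists D.
  by exists A => //; exists D.
- move=> _ _ [X1 [mX1 [X2 [mX2 ->]]]] [Y1 [mY1 [Y2 [mY2 ->]]]].
  rewrite -setXI; exists (X1 `&` Y1); split; first exact: measurableI.
  by exists (X2 `&` Y2); split => //; exact: measurableI.
- by move=> _; exists setT; split => //; exists setT; split => //; rewrite setXTT.
- by rewrite bigcup_const.
- move=> _ [A [mA [D [mD ->]]]].
  rewrite -[RHS]/((fine (leb n B))%:E *
    ball_measure (@enorm R n @^-1` A `&` dir @^-1` D))%E fineK//.
  rewrite polar_indep// -product_measure1E//.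
    rewrite -[X in measurable X]setTI; exact: measurable_enorm.
  rewrite -[X in measurable X]setTI; exact: measurable_dir.
- move=> _; rewrite -[X in (X < _)%E]/((ball_measure \x ball_measure)%E setT).
  rewrite -setXTT product_measure1E// -ge0_fin_numE ?mule_ge0//.
  by apply: fin_numM; exact: fin_num_measure.
Qed.

(** Polar coordinates without the surface measure of the sphere: if x and y are
    independent and uniform in the ball, then so is the point with the norm of x
    and the direction of y. *)
Lemma polar_average (F : V -> \bar R) :
  measurable_fun [set: V] F -> (forall x, 0 <= F x)%E ->
  measurable_fun [set: V] (fun y => \int[ball_measure]_x F (enorm x *: dir y)%R)%E /\
  (\int[ball_measure]_y \int[ball_measure]_x F (enorm x *: dir y)%R =
   leb n B * \int[ball_measure]_x F x)%E.
Proof.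
move=> mF F0.
have mS : measurable_fun [set: V * V] (fun p : V * V => (enorm p.1, dir p.2)).
  apply: measurable_fun_pair; apply: measurableT_comp => //.
    exact: measurable_enorm.
  exact: measurable_dir.
have mT : measurable_fun [set: V] (fun x : V => (enorm x, dir x)).
  apply: measurable_fun_pair; [exact: measurable_enorm|exact: measurable_dir].
have mG : measurable_fun [set: R * V] (fun p : R * V => F (p.1 *: p.2)).
  apply: measurableT_comp mF _; exact: measurable_scale_row.
have mH : measurable_fun [set: V * V] (fun p : V * V => F (enorm p.1 *: dir p.2)).
  exact: measurableT_comp mG mS.
split.
  by apply: (measurable_fun_fubini_tonelli_G (m1 := ball_measure) _ mH) => p.
rewrite -[LHS](fubini_tonelli2 (m1 := ball_measure) (m2 := ball_measure) _ mH)//.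
have fB : leb n B \is a fin_num := leb_ball_fin_num.
have b0 : 0 <= fine (leb n B) by rewrite fine_ge0.
pose m1 : {measure set (R * V) -> \bar R} :=
  image_measure (ball_measure \x ball_measure)%E mS.
pose m2 : {measure set (R * V) -> \bar R} :=
  mscale (NngNum b0) (image_measure ball_measure mT).
transitivity (\int[m1]_p F (p.1 *: p.2))%E.
  by rewrite /m1 ge0_integral_pushforward.
transitivity (\int[m2]_p F (p.1 *: p.2))%E.
  apply: eq_measure_integral => A mA _.
  rewrite -[RHS]/((fine (leb n B))%:E *
    ball_measure ((fun x : V => (enorm x, dir x)) @^-1` A))%E fineK//.
  exact: polar_product.
rewrite /m2 ge0_integral_mscale//= fineK//; congr (_ * _)%E.
rewrite ge0_integral_pushforward//; apply: eq_integral => x _ /=.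
by rewrite enorm_dirK.
Qed.

End polar.

(** * Test functions *)

Section test_functions.
Context {R : realType} {n : nat}.
Local Notation V := 'rV[R]_n.
Local Notation B := (unit_ball n : set V).
Local Notation e_ i := (delta_mx 0 i : V).
Implicit Types (f phi psi : V -> R) (x v : V).

Lemma diff_partial phi x v : differentiable phi x ->
  'd phi x v = \sum_(i < n) v 0 i * partial i phi x.
Proof.
move=> dphi; rewrite {1}(row_sum_delta v) linear_sum.
by apply: eq_bigr => i _; rewrite linearZ /partial deriveE.
Qed.

Lemma partial_near0 f x i : (\forall y \near x, f y = 0) -> partial i f x = 0.
Proof.
move=> f0; rewrite /partial (@near_eq_derive _ _ _ _ (cst 0))//.
exact: derive_cst.
Qed.

Lemma smooth_differentiable phi x : smooth phi -> differentiable phi x.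
Proof. by move=> /(_ [::]). Qed.

Lemma smooth_partial phi i : smooth phi -> smooth (partial i phi).
Proof. by move=> sphi s x; have := sphi (rcons s i) x; rewrite foldr_rcons. Qed.

Lemma smooth_continuous phi : smooth phi -> continuous phi.
Proof.
by move=> sphi x; apply: differentiable_continuous; exact: smooth_differentiable.
Qed.

Lemma near_off_support phi x :
  ~ closure [set x | phi x != 0] x -> \forall y \near x, phi y = 0.
Proof.
move=> Nx; have : open (~` closure [set x | phi x != 0]).
  by apply: closed_openC; exact: closed_closure.
move=> oC; have := open_nbhs_nbhs (conj oC Nx).
apply: filterS => y Ny; apply/eqP/negPn/negP => py.
by apply: Ny; exact: subset_closure.
Qed.

Lemma test_off_ball phi x : test_function phi -> ~ B x -> phi x = 0.
Proof.
move=> tphi NBx; apply: nbhs_singleton (near_off_support _).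
by case: tphi => _ _ sB; apply: contra_not NBx => /sB.
Qed.

Lemma test_partial phi i : test_function phi -> test_function (partial i phi).
Proof.
move=> tphi; case: (tphi) => sphi cphi Bphi.
have sub : closure [set x | partial i phi x != 0] `<=` closure [set x | phi x != 0].
  have /closure_id cl := @closed_closure _ [set x | phi x != 0].
  rewrite [X in _ `<=` X]cl; apply: closureS => x /= /eqP dx; apply: contrapT => Nx; apply: dx.
  exact: partial_near0 (near_off_support Nx).
split; first exact: smooth_partial.
  by apply: subclosed_compact cphi sub; exact: closed_closure.
exact: subset_trans sub Bphi.
Qed.

Lemma compact_cube r : compact (cube r : set V).
Proof.
by apply: (@rV_compact _ _ (fun=> `[- r, r]%classic)) => _; exact: segment_compact.
Qed.

Lemma continuous_bounded f : continuous f -> (forall x, ~ B x -> f x = 0) ->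
  exists2 C, 0 <= C & forall x, `|f x| <= C.
Proof.
move=> cf f0; have : compact (f @` cube 1).
  apply: continuous_compact; last exact: compact_cube.
  by apply: continuous_subspaceT.
move=> /compact_bounded[M [Mreal MP]]; exists (`|M| + 1); first by rewrite addr_ge0.
move=> x; have [Bx|/f0->] := pselect (B x); last by rewrite normr0 addr_ge0.
apply: MP; first by rewrite (le_lt_trans (ler_norm _))// ltrDl.
by exists x => //; exact: unit_ball_cube.
Qed.

Lemma test_bounded phi : test_function phi -> exists2 C, 0 <= C & forall x, `|phi x| <= C.
Proof.
move=> tphi; apply: continuous_bounded => [|x]; last exact: test_off_ball.
by case: tphi => sphi _ _; exact: smooth_continuous.
Qed.

Lemma test_measurable phi : test_function phi -> measurable_fun [set: V] phi.
Proof.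
by case=> sphi _ _; apply: continuous_measurable_row; exact: smooth_continuous.
Qed.

Lemma measurable_gradient phi i : test_function phi ->
  measurable_fun [set: V] (fun x => gradient phi x 0 i).
Proof.
move=> tphi; under eq_fun do rewrite mxE.
by apply: test_measurable; exact: test_partial.
Qed.

End test_functions.

(** * Integration by parts *)

Section integration_by_parts.
Context {R : realType} {n : nat}.
Local Notation V := 'rV[R]_n.
Local Notation B := (unit_ball n : set V).
Local Notation e_ i := (delta_mx 0 i : V).

Lemma integrable_cube r (f : V -> R) C : measurable_fun [set: V] f ->
  (forall x, `|f x| <= C * \1_(cube r) x) ->
  (leb n).-integrable [set: V] (EFin \o f).
Proof.
move=> mf fC; apply: (@le_integrable _ _ _ _ _ measurableT _
    (fun x => C%:E * (\1_(cube r : set V) x)%:E)%E).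
- exact/measurable_EFinP.
- by move=> x _ /=; rewrite lee_fin (le_trans (fC x))// ler_norm.
have mK : measurable (cube r : set V) := measurable_cube r.
apply: integrableZl => //; apply/integrableP; split; first exact/measurable_EFinP.
under eq_integral do rewrite gee0_abs ?lee_fin//.
by rewrite integral_indic// setIT; exact: leb_cube_lty.
Qed.

Lemma measurable_translate (a : V) : measurable_fun [set: V] (fun x => x + a).
Proof.
apply: measurable_row_fun => // i.
rewrite (_ : (fun _ => _) = fun x : V => x 0 i + a 0 i); last first.
  by apply/funext => x; rewrite mxE.
by apply: measurable_funD => //; exact: measurable_coord.
Qed.

Lemma leb_translation (a : V) (A : set V) : measurable A ->
  leb n ((fun x => x + a) @^-1` A) = leb n A.
Proof.
move=> mA; rewrite [RHS](leb_affine a ltr01 mA) expr1n mul1e.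
by under [in RHS]eq_fun do rewrite scale1r.
Qed.

Lemma integral_translation (a : V) (F : V -> \bar R) :
  (leb n).-integrable [set: V] F ->
  (leb n).-integrable [set: V] (fun x => F (x + a)) /\
  (\int[leb n]_x F (x + a)%R = \int[leb n]_x F x)%E.
Proof.
move=> iF; have [mF _] := integrableP _ _ _ iF.
have mFa : measurable_fun [set: V] (fun x => F (x + a)).
  exact: measurableT_comp mF (measurable_translate a).
have E (G : V -> \bar R) : measurable_fun [set: V] G -> (forall x, 0 <= G x)%E ->
   (\int[leb n]_x G (x + a)%R = \int[leb n]_x G x)%E.
  move=> mG G0.
  rewrite [RHS](eq_measure_integral (image_measure (leb n) (measurable_translate a))).
    rewrite [RHS](@ge0_integral_pushforward _ _ _ _ _ _ (measurable_translate a))//.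
  by move=> A mA _; rewrite -[RHS]/(leb n ((fun x => x + a) @^-1` A)) leb_translation.
have iFa : (leb n).-integrable [set: V] (fun x => F (x + a)).
  apply/integrableP; split => //.
  rewrite (E (fun x => `|F x|)%E)//; first by case/integrableP: iF.
  exact: measurableT_comp.
split=> //; rewrite [RHS](eq_measure_integral (image_measure (leb n) (measurable_translate a))).
  by rewrite [RHS](integral_pushforward (measurable_translate a)).
by move=> A mA _; rewrite -[RHS]/(leb n ((fun x => x + a) @^-1` A)) leb_translation.
Qed.

Lemma is_derive_line (F : V -> R) (x v : V) (t : R) : differentiable F (x + t *: v) ->
  is_derive t 1 (fun s : R => F (x + s *: v)) ('D_v F (x + t *: v)).
Proof.
move=> dF; have /= dFv := diff_derivable (v := v) dF.
have E : (fun h => h^-1 *: (((fun s : R => F (x + s *: v)) \o shift t) (h *: (1 : R)) -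
                            F (x + t *: v))) =
    (fun h => h^-1 *: ((F \o shift (x + t *: v)) (h *: v) - F (x + t *: v))).
  apply/funext => h /=; congr (_ *: (F _ - _)).
  by rewrite [h%:A]mulr1 scalerDl addrCA.
by apply: DeriveDef; rewrite /derivable /derive E.
Qed.

Lemma increment_bound (F : V -> R) (v : V) C x (h : R) : (forall y, differentiable F y) ->
  (forall y, `|'D_v F y| <= C) -> 0 < h -> `|h^-1 * (F (x + h *: v) - F x)| <= C.
Proof.
move=> dF FC h0.
have dl (t : R) : is_derive t 1 (fun s : R => F (x + s *: v)) ('D_v F (x + t *: v)).
  exact: is_derive_line.
have [//|c _] := @MVT_segment R (fun s => F (x + s *: v))
  (fun s => 'D_v F (x + s *: v)) 0 h (ltW h0).
  apply: continuous_subspaceT => t; apply: differentiable_continuous.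
  by apply/derivable1_diffP; exact: (@ex_derive _ _ _ _ _ _ _ (dl t)).
rewrite scale0r addr0 subr0 => ->; rewrite mulrCA mulVf ?gt_eqF// mulr1.
exact: FC.
Qed.

(** The integral of a difference quotient vanishes because the measure is
    invariant under translations; the quotients converge to the partial
    derivative, and the mean value theorem dominates them. *)
Lemma integral_partial0 (F : V -> R) i : (forall x, differentiable F x) ->
  continuous (partial i F) -> (forall x, ~ B x -> F x = 0) ->
  (forall x, ~ B x -> partial i F x = 0) ->
  (\int[leb n]_(x in B) (partial i F x)%:E = 0)%E.
Proof.
move=> dF cF F0 dF0.
have cF' : continuous F by move=> x; exact: differentiable_continuous.
have [C C0 FC] := continuous_bounded cF' F0.
have [D D0 FD] := continuous_bounded cF dF0.
have mF : measurable_fun [set: V] F by exact: continuous_measurable_row.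
have iF : (leb n).-integrable [set: V] (EFin \o F).
  apply: (@integrable_cube 1 _ C) => // x.
  have [Bx|/F0->] := pselect (B x).
    by rewrite indicE mem_set ?mulr1//; exact: unit_ball_cube.
  by rewrite normr0 mulr_ge0.
pose h (k : nat) : R := k.+1%:R^-1.
have h0 k : 0 < h k by rewrite invr_gt0.
have h1 k : h k <= 1 by rewrite invf_le1// ler1n.
pose q k x := (h k)^-1 * (F (x + h k *: e_ i) - F x).
have q0 k : (\int[leb n]_x (q k x)%:E = 0)%E.
  have [iFa eFa] := integral_translation (h k *: e_ i) iF.
  under eq_integral do rewrite /q EFinM EFinB.
  rewrite integralZl//; last exact: integrableB.
  by rewrite integralB// eFa subee ?mule0//; exact: integrable_fin_num.
have mq k : measurable_fun [set: V] (q k).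
  apply: measurable_funM => //; apply: measurable_funB => //.
  exact: measurableT_comp mF (measurable_translate _).
rewrite integral_mkcond.
have -> : (\int[leb n]_x ((fun x => (partial i F x)%:E) \_ B) x =
           \int[leb n]_x (partial i F x)%:E)%E.
  apply: eq_integral => x _; rewrite patchE; case: ifPn => // /negP Bx.
  by rewrite dF0// => /mem_set.
have cvq x : q ^~ x @ \oo --> partial i F x.
  have /= cD := diff_derivable (v := e_ i) (dF x).
  have -> : q ^~ x = fun k => (h k)^-1 *: (F (h k *: e_ i + x) - F x).
    by apply/funext => k; rewrite /q [h k *: e_ i + x]addrC.
  apply: ((cvgr_dnbhsP _ _ _).1 cD h); split; last exact: cvg_harmonic.
  by move=> k; rewrite gt_eqF.
(* Steps of length at most 1 keep the translated supports in a fixed cube. *)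
have [|||||_ _] := @dominated_convergence _ _ _ (leb n) [set: V] measurableT
  (fun k x => (q k x)%:E) (fun x => (partial i F x)%:E)
  (fun x => (D * \1_(cube 2) x)%:E).
- by move=> k; exact/measurable_EFinP.
- by apply/measurable_EFinP; exact: continuous_measurable_row.
- by apply: aeW => x _; apply: cvg_EFin; [near=> k|exact: cvq].
- apply: (@integrable_cube 2 _ D) => [|x]; last by rewrite ger0_norm// mulr_ge0.
  by apply: measurable_funM => //; apply: measurable_indic; exact: measurable_cube.
- apply: aeW => x k _; rewrite lee_fin.
  have [Kx|Kx] := pselect (cube 2 x).
    by rewrite indicE mem_set// mulr1; exact: increment_bound.
  rewrite [X in `|X|](_ : _ = 0) ?normr0 ?mulr_ge0//.
  rewrite /q !F0 ?subrr ?mulr0// => /unit_ball_cube xK; apply: Kx => j /=;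
    rewrite in_itv/= -ler_norml; have := xK j; rewrite /= in_itv/= -ler_norml.
    by move=> /le_trans; apply; rewrite ler1n.
  move=> xj; rewrite -(addrK (h k * e_ i 0 j) (x 0 j)).
  apply: le_trans (ler_normB _ _) _; rewrite (_ : 2 = 1 + 1)// lerD//.
    by move: xj; rewrite !mxE.
  rewrite normrM gtr0_norm// mxE /= -[leRHS]mulr1 ler_pM// ?(ltW (h0 k))//.
  by case: (j == i); rewrite ?normr0 ?normr1 ?ler01.
under eq_fun do rewrite q0.
by move=> /cvg_lim <-//; rewrite lim_cst.
Unshelve. all: by end_near.
Qed.

Lemma integration_by_parts (u phi : V -> R) i : smooth u -> test_function phi ->
  (\int[leb n]_(x in B) (u x * partial i phi x + partial i u x * phi x)%:E = 0)%E.
Proof.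
move=> su tphi; have [sphi _ _] := tphi.
have d x : differentiable u x /\ differentiable phi x.
  by split; exact: smooth_differentiable.
have E : partial i (u * phi) = fun x => u x * partial i phi x + partial i u x * phi x.
  apply/funext => x; have [du dphi] := d x.
  rewrite /partial deriveM; [|exact: diff_derivable|exact: diff_derivable].
  by rewrite /GRing.scale/= [phi x * _]mulrC.
transitivity (\int[leb n]_(x in B) (partial i (u * phi) x)%:E)%E.
  by rewrite E.
apply: integral_partial0.
- by move=> x; have [du dphi] := d x; exact: differentiableM.
- have cu := smooth_continuous su; have cphi := smooth_continuous sphi.
  have cdu := smooth_continuous (smooth_partial i su).
  have cdphi := smooth_continuous (smooth_partial i sphi).
  rewrite E => x; exact: (cvgD (cvgM (cu x) (cdphi x)) (cvgM (cdu x) (cphi x))).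
- by move=> x Bx; rewrite /GRing.mul/= (test_off_ball tphi Bx) mulr0.
- move=> x Bx; rewrite E (test_off_ball tphi Bx).
  by rewrite (test_off_ball (test_partial i tphi) Bx) !mulr0 addr0.
Qed.

End integration_by_parts.

(** * A criterion for membership in the closure of the test functions *)

Section H10_closure.
Context {R : realType} {n : nat}.
Local Notation V := 'rV[R]_n.
Local Notation B := (unit_ball n : set V).

Let mB : measurable B := measurable_unit_ball.

(** The integrand of the squared distance in H^1. *)
Definition sq_dist (u : V -> R) (G : V -> V) (v : V -> R) (H : V -> V) (x : V) : R :=
  (u x - v x) ^+ 2 + enorm (G x - H x) ^+ 2.

Lemma sq_dist_ge0 u G v H x : 0 <= sq_dist u G v H x.
Proof. by rewrite addr_ge0 ?sqr_ge0. Qed.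

Lemma measurable_sq_enorm d (T : measurableType d) (D : set T) (G : T -> V) :
  measurable D -> (forall i, measurable_fun D (fun x => G x 0 i)) ->
  measurable_fun D (fun x => enorm (G x) ^+ 2).
Proof.
move=> mD mG; under eq_fun do rewrite sqr_enorm.
by apply: measurable_sum => i; exact: measurable_funX.
Qed.

Lemma measurable_sq_dist d (T : measurableType d) (D : set T) (u v : T -> R) (G H : T -> V) :
  measurable D -> measurable_fun D u -> measurable_fun D v ->
  (forall i, measurable_fun D (fun x => G x 0 i)) ->
  (forall i, measurable_fun D (fun x => H x 0 i)) ->
  measurable_fun D (fun x => (u x - v x) ^+ 2 + enorm (G x - H x) ^+ 2).
Proof.
move=> mD mu mv mG mH; apply: measurable_funD.
  by apply: measurable_funX; exact: measurable_funB.
apply: measurable_sq_enorm => // i; under eq_fun do rewrite !mxE.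
exact: measurable_funB.
Qed.

Lemma integrable_ball_cst (c : R) : (leb n).-integrable B (fun=> c%:E).
Proof.
apply/integrableP; split=> //; rewrite integral_cst//= lte_mul_pinfty//.
exact: leb_ball_lty.
Qed.

(** A function at finite L^2 distance from a bounded one is in L^2, as the ball
    has finite measure. *)
Lemma integrable_sq_approx (a b : V -> R) C : measurable_fun B a -> measurable_fun B b ->
  (forall x, `|b x| <= C) -> (\int[leb n]_(x in B) ((a x - b x) ^+ 2)%:E < +oo)%E ->
  (leb n).-integrable B (fun x => (a x ^+ 2)%:E).
Proof.
move=> ma mb bC fin.
have iab : (leb n).-integrable B (fun x => ((a x - b x) ^+ 2)%:E).
  apply/integrableP; split.
    by apply/measurable_EFinP; apply: measurable_funX; exact: measurable_funB.
  by under eq_integral do rewrite gee0_abs ?lee_fin ?sqr_ge0//.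
apply: (@le_integrable _ _ _ _ _ mB _
    (fun x => 2%:E * ((a x - b x) ^+ 2)%:E + (2 * C ^+ 2)%:E)%E).
- by apply/measurable_EFinP; exact: measurable_funX.
- move=> x _; rewrite -EFinM -EFinD !abse_EFin lee_fin ger0_norm ?sqr_ge0//.
  suff h : a x ^+ 2 <= 2 * (a x - b x) ^+ 2 + 2 * C ^+ 2.
    by rewrite (le_trans h)// ler_norm.
  have : `|b x| ^+ 2 <= C ^+ 2 by rewrite ler_sqr ?nnegrE// (le_trans _ (bC x)).
  rewrite real_normK ?num_real//; have := sqr_ge0 (a x - 2 * b x).
  move: (a x) (b x) => s t; nra.
- by apply: integrableD => //; [exact: integrableZl|exact: integrable_ball_cst].
Qed.

Lemma integrable_mul_bounded (a b : V -> R) C : square_integrable a ->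
  measurable_fun B b -> (forall x, `|b x| <= C) ->
  (leb n).-integrable B (fun x => (a x * b x)%:E).
Proof.
move=> [ma ia] mb bC.
apply: (@le_integrable _ _ _ _ _ mB _ (fun x => C%:E * ((a x ^+ 2)%:E + 1%:E))%E).
- by apply/measurable_EFinP; exact: measurable_funM.
- move=> x _; rewrite -EFinD -EFinM !abse_EFin lee_fin.
  apply: (@le_trans _ _ (C * (a x ^+ 2 + 1))); last exact: ler_norm.
  rewrite [leLHS]normrM mulrC ler_pM// -real_normK ?num_real//.
  have := sqr_ge0 (`|a x| - 1); have := normr_ge0 (a x).
  by move: `|a x| => s; nra.
- by apply: integrableZl => //; apply: integrableD => //; exact: integrable_ball_cst.
Qed.

Lemma test_square_integrable phi : test_function phi -> square_integrable (phi : V -> R).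
Proof.
move=> t; have [C C0 phiC] := test_bounded t.
have m : measurable_fun B phi by apply: measurable_funTS; exact: test_measurable.
split=> //; apply: (integrable_sq_approx m m phiC).
by under eq_integral do rewrite subrr expr0n/=; rewrite integral0.
Qed.

(** The closure of the test functions, without assuming that the limit has a weak
    gradient: integration by parts passes from the test functions to the limit.
    The inequality of Cauchy and Schwarz is replaced by the elementary bound
    |a| <= de / 2 + a^2 / (2 de), used with an approximation of squared distance
    de^2. *)
Lemma H10_approx (u : V -> R) (G : V -> V) : measurable_fun B u ->
  (forall i, measurable_fun B (fun x => G x 0 i)) ->
  (forall e : R, 0 < e -> exists2 phi : V -> R, test_function phi &
     (\int[leb n]_(x in B) (sq_dist u G phi (gradient phi) x)%:E < e%:E)%E) ->
  H10_grad u G.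
Proof.
move=> mu mG approx.
have tm phi : test_function phi -> measurable_fun B phi.
  by move=> t; apply: measurable_funTS; exact: test_measurable.
have tmi phi i : test_function phi -> measurable_fun B (partial i phi).
  by move=> t; apply: tm; exact: test_partial.
have mE phi : test_function phi ->
    measurable_fun B (fun x => (sq_dist u G phi (gradient phi) x)%:E).
  move=> t; apply/measurable_EFinP; apply: measurable_sq_dist => //; first exact: tm.
  by move=> i; apply: measurable_funTS; exact: measurable_gradient.
have leE phi x i : ((G x 0 i - partial i phi x) ^+ 2 <= sq_dist u G phi (gradient phi) x).
  rewrite /sq_dist sqr_enorm (bigD1 i)//= !mxE addrCA lerDl addr_ge0 ?sqr_ge0//.
  by apply: sumr_ge0 => j _; exact: sqr_ge0.
have leu phi x : ((u x - phi x) ^+ 2 <= sq_dist u G phi (gradient phi) x).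
  by rewrite lerDl sqr_ge0.
have [phi0 t0 fin0] := approx 1 ltr01.
have su : square_integrable u.
  split=> //; have [C C0 phiC] := test_bounded t0.
  apply: (integrable_sq_approx mu (tm _ t0) phiC).
  apply: le_lt_trans (lt_trans fin0 (ltry _)).
  apply: ge0_le_integral => //.
  - by move=> x _; rewrite lee_fin sqr_ge0.
  - apply/measurable_EFinP; apply: measurable_funX; apply: measurable_funB => //; exact: tm.
  - exact: mE.
  - by move=> x _; rewrite lee_fin.
have sG i : square_integrable (fun x => G x 0 i).
  split=> //; have [C C0 phiC] := test_bounded (test_partial i t0).
  apply: (integrable_sq_approx (mG i) (tmi _ i t0) phiC).
  apply: le_lt_trans (lt_trans fin0 (ltry _)).
  apply: ge0_le_integral => //.
  - by move=> x _; rewrite lee_fin sqr_ge0.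
  - apply/measurable_EFinP; apply: measurable_funX; apply: measurable_funB => //; exact: tmi.
  - exact: mE.
  - by move=> x _; rewrite lee_fin.
split; last first.
  have /choice[phi phiP] k : exists phi, test_function phi /\
     (\int[leb n]_(x in B) (sq_dist u G phi (gradient phi) x)%:E < k.+1%:R^-1%:E)%E.
    by have [|phi t lt] := approx k.+1%:R^-1; [rewrite invr_gt0|exists phi].
  exists phi; split; first by move=> k; have [] := phiP k.
  apply: (@squeeze_cvge _ _ _ _ (fun=> 0%E) _ (fun k => (@harmonic R k)%:E)).
  - near=> k; apply/andP; split; last by have [_ /ltW] := phiP k.
    by apply: integral_ge0 => x _; rewrite lee_fin sq_dist_ge0.
  - exact: cvg_cst.
  - by apply: cvg_EFin; [near=> k|exact: cvg_harmonic].
split=> // psi i tpsi.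
have [C1 C10 psiC1] := test_bounded tpsi.
have [C2 C20 psiC2] := test_bounded (test_partial i tpsi).
have i1 := integrable_mul_bounded su (tmi _ i tpsi) psiC2.
have i2 := integrable_mul_bounded (sG i) (tm _ tpsi) psiC1.
apply/eqP; rewrite -subr_eq0 opprK -RintegralD//.
set J := (X in X == 0).
have iJ : (leb n).-integrable B
    (fun x => (u x * partial i psi x + G x 0 i * psi x)%:E).
  by under eq_fun do rewrite EFinD; exact: integrableD.
have JE : (\int[leb n]_(x in B) (u x * partial i psi x + G x 0 i * psi x)%:E = J%:E)%E.
  by rewrite /J /Rintegral fineK//; exact: integrable_fin_num.
have [C [C0 CC1 CC2]] : exists C, [/\ 0 < C, C1 <= C & C2 <= C].
  by exists (C1 + C2 + 1); split; lra.
have [b bE b0] : exists2 b : R, leb n B = b%:E & 0 <= b.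
  exists (fine (leb n B)); last by rewrite fine_ge0.
  by rewrite fineK// ge0_fin_numE ?measure_ge0// leb_ball_lty.
have bound (de : R) : 0 < de -> `|J| <= C * (de * b + de / 2).
  move=> de0; have [phi tphi phie] := approx (de ^+ 2) (exprn_gt0 2 de0).
  have sphi : smooth phi by case: tphi.
  have sqphi := test_square_integrable tphi.
  have sqdphi := test_square_integrable (test_partial i tphi).
  have j1 := integrable_mul_bounded sqphi (tmi _ i tpsi) psiC2.
  have j2 := integrable_mul_bounded sqdphi (tm _ tpsi) psiC1.
  have jI : (leb n).-integrable B
      (fun x => (phi x * partial i psi x + partial i phi x * psi x)%:E).
    by under eq_fun do rewrite EFinD; exact: integrableD.
  pose h x := (u x - phi x) * partial i psi x + (G x 0 i - partial i phi x) * psi x.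
  have hE : (fun x => (h x)%:E) =
      ((fun x => (u x * partial i psi x + G x 0 i * psi x)%:E) \-
      (fun x => (phi x * partial i psi x + partial i phi x * psi x)%:E))%E.
    by apply/funext => x; rewrite /= -EFinB; congr EFin; rewrite /h; ring.
  have ih : (leb n).-integrable B (fun x => (h x)%:E) by rewrite hE; exact: integrableB.
  have hJ : (\int[leb n]_(x in B) (h x)%:E = J%:E)%E.
    by rewrite hE integralB// JE (integration_by_parts i sphi tpsi) sube0.
  have mh : measurable_fun B h.
    apply: measurable_funD; apply: measurable_funM.
    - by apply: measurable_funB => //; exact: tm.
    - exact: tmi.
    - by apply: measurable_funB => //; exact: tmi.
    - exact: tm.
  pose g x := sq_dist u G phi (gradient phi) x.
  have hg x : `|h x| <= C * (de + (2 * de)^-1 * g x).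
    apply: (@le_trans _ _ (C * `|u x - phi x| + C * `|G x 0 i - partial i phi x|)).
      apply: le_trans (ler_normD _ _) _; rewrite !normrM lerD// mulrC ler_pM//.
        exact: le_trans (psiC2 x) CC2.
      exact: le_trans (psiC1 x) CC1.
    rewrite -mulrDr ler_pM2l//.
    have : `|u x - phi x| ^+ 2 + `|G x 0 i - partial i phi x| ^+ 2 <= g x.
      rewrite /g /sq_dist !real_normK ?num_real// lerD2l sqr_enorm (bigD1 i)//=.
      rewrite !mxE lerDl; apply: sumr_ge0 => j _; exact: sqr_ge0.
    move: `|u x - phi x| `|G x 0 i - partial i phi x| (g x) => s t r srt.
    have -> : de + (2 * de)^-1 * r = (2 * de)^-1 * (2 * de ^+ 2 + r).
      by field; rewrite gt_eqF.
    rewrite ler_pdivlMl ?mulr_gt0//.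
    have := sqr_ge0 (s - de); have := sqr_ge0 (t - de); nra.
  have le : (`|\int[leb n]_(x in B) (h x)%:E| <= (C * (de * b + de / 2))%:E)%E.
    apply: (@le_trans _ _ (\int[leb n]_(x in B) (C * (de + (2 * de)^-1 * g x))%:E)%E).
      apply: le_trans (le_abse_integral _ _ _) _ => //; first exact/measurable_EFinP.
      apply: ge0_le_integral => //.
      - by apply: measurableT_comp => //; exact/measurable_EFinP.
      - apply/measurable_EFinP; apply: measurable_funM => //.
        by apply: measurable_funD => //; apply: measurable_funM => //;
          apply/measurable_EFinP; exact: mE.
      - by move=> x _; rewrite abse_EFin lee_fin.
    under eq_integral do rewrite EFinM EFinD (EFinM (2 * de)^-1).
    have d2 : 0 <= (2 * de)^-1 by rewrite invr_ge0 mulr_ge0// ltW.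
    have mg : measurable_fun B (fun x => ((2 * de)^-1%:E * (g x)%:E)%E).
      by apply: emeasurable_funM => //; exact: mE.
    have g0 x : B x -> (0 <= (2 * de)^-1%:E * (g x)%:E)%E.
      by rewrite mule_ge0 ?lee_fin//; exact: sq_dist_ge0.
    have deE : (0 <= de%:E)%E by rewrite lee_fin ltW.
    have CE : (0 <= C%:E)%E by rewrite lee_fin ltW.
    have dg0 x : B x -> (0 <= de%:E + (2 * de)^-1%:E * (g x)%:E)%E.
      by move=> Bx; rewrite adde_ge0// g0.
    rewrite ge0_integralZl//; last exact: emeasurable_funD.
    rewrite ge0_integralD// integral_cst// ge0_integralZl//; last 2 first.
    - exact: mE.
    - by move=> x _; rewrite lee_fin; exact: sq_dist_ge0.
    rewrite bE EFinM lee_pmul2l ?lte_fin// EFinD -EFinM; apply: leeD => //.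
    have -> : de / 2 = (2 * de)^-1 * de ^+ 2 by field; rewrite gt_eqF.
    by rewrite EFinM lee_pmul2l ?lte_fin ?invr_gt0 ?mulr_gt0//; exact: ltW.
  by rewrite -lee_fin -abse_EFin -hJ.
have [//|J0] := eqVneq J 0; exfalso.
(* The bound is linear in de; this de makes it half of |J|. *)
have K0 : 0 < C * (b + 1 / 2) by rewrite mulr_gt0// ltr_wpDl// divr_gt0.
have := bound (`|J| / (2 * (C * (b + 1 / 2)))).
rewrite divr_gt0 ?normr_gt0// ?(mulr_gt0 (ltr0Sn R 1) K0)// => /(_ isT).
have -> : C * (`|J| / (2 * (C * (b + 1 / 2))) * b +
               `|J| / (2 * (C * (b + 1 / 2))) / 2) = `|J| / 2.
  move: K0 b0 C0; clear; move: `|J| => j K0 b0 C0.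
  have b1 : b * 2 + 1 != 0 by rewrite gt_eqF//; lra.
  by field; rewrite b1 gt_eqF.
by have := J0; rewrite -normr_gt0; clear; move: `|J| => j ? ?; lra.
Unshelve. all: by end_near.
Qed.

End H10_closure.

(** * Smoothing of radial profiles *)

Section radial_regularization.
Context {R : realType} {n : nat}.
Local Notation V := 'rV[R]_n.
Local Notation B := (unit_ball n : set V).
Local Notation e_ i := (delta_mx 0 i : V).

Lemma chain_rule (f : V -> R) (g : R -> R) (g' : R) (x v : V) :
  differentiable f x -> is_derive (f x) 1 g g' ->
  differentiable (g \o f) x /\ 'D_v (g \o f) x = g' * 'D_v f x.
Proof.
move=> df dg.
have dg' : differentiable g (f x).
  by apply/derivable1_diffP; exact: (@ex_derive _ _ _ _ _ _ _ dg).
have dgf : differentiable (g \o f) x by exact: differentiable_comp.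
split=> //; rewrite deriveE// diff_comp//= diff1E//= derive1E.
by rewrite (@derive_val _ _ _ _ _ _ _ dg) deriveE// /GRing.scale/= mulrC.
Qed.

Lemma is_derive_coord (x v : V) j : is_derive x v (fun y : V => y 0 j) (v 0 j).
Proof.
apply: DeriveDef; first by apply: diff_derivable; exact: differentiable_coord.
have /derive_mx : derivable (id : V -> V) x v by exact: derivable_id.
by rewrite derive_id => /matrixP/(_ 0 j); rewrite mxE.
Qed.

Variable e : R.
Hypothesis e0 : 0 < e.

(** The norm is replaced by a smooth function that is larger, so that a profile
    vanishing beyond a radius gives a function vanishing beyond that radius. *)
Definition smooth_norm (x : V) : R := Num.sqrt (\sum_(i < n) x 0 i ^+ 2 + e ^+ 2).
Local Notation rho := smooth_norm.

Lemma smooth_norm_gt0 x : 0 < rho x.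
Proof. by rewrite sqrtr_gt0 ltr_wpDl ?sumsq_ge0// exprn_gt0. Qed.

Lemma enorm_le_smooth_norm x : enorm x <= rho x.
Proof. by rewrite ler_wsqrtr// lerDl sqr_ge0. Qed.

Lemma diff_smooth_norm x : differentiable rho x /\
  forall i, partial i rho x = x 0 i * (rho x)^-1.
Proof.
pose q (y : V) := \sum_(i < n) y 0 i ^+ 2 + e ^+ 2.
have qE : q = \sum_(i < n) (fun y : V => y 0 i) ^+ 2 + cst (e ^+ 2).
  by apply/funext => y; rewrite /q fctE fct_sumE.
have dq : differentiable q x.
  rewrite qE; apply: differentiableD => //; apply: differentiable_sum => i.
  by apply: differentiableX; exact: differentiable_coord.
have Dq i : 'D_(e_ i) q x = 2 * x 0 i.
  have Dc j : is_derive x (e_ i) ((fun y : V => y 0 j) ^+ 2)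
      ((2 * x 0 j ^+ 1) *: ((e_ i : V) 0 j)).
    by have := is_derive_coord x (e_ i) j; exact: is_deriveX.
  rewrite qE (@derive_val _ _ _ _ _ _ _ (is_deriveD (is_derive_sum Dc) _)) addr0.
  rewrite (bigD1 i)//= big1 => [|j ji]; last first.
    by rewrite mxE (negbTE ji) andbF scaler0.
  by rewrite mxE !eqxx/= addr0 expr1 [_ *: _]mulr1.
have q0 : 0 < q x by have := smooth_norm_gt0 x; rewrite sqrtr_gt0.
split=> [|i]; first exact: (chain_rule 0 dq (is_derive1_sqrt q0)).1.
rewrite /partial (chain_rule (e_ i) dq (is_derive1_sqrt q0)).2 Dq.
rewrite /rho -/(q x); have : Num.sqrt (q x) != 0 by rewrite gt_eqF// sqrtr_gt0.
by move: (Num.sqrt (q x)) => s s0; field.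
Qed.

Variables (phi : V -> R) (th : V).
Hypothesis sphi : smooth phi.

(** A class of functions that contains the smoothed profile, consists of
    differentiable functions and is closed under partial derivatives, hence
    consists of smooth functions. *)
Inductive regular : (V -> R) -> Prop :=
| regular_cst c : regular (fun=> c)
| regular_coord i : regular (fun x => x 0 i)
| regular_inv_norm : regular (fun x => (rho x)^-1)
| regular_profile s : regular (fun x => foldr (@partial R n) phi s (rho x *: th))
| regular_add f g : regular f -> regular g -> regular (fun x => f x + g x)
| regular_mul f g : regular f -> regular g -> regular (fun x => f x * g x).

Lemma diff_profile (psi : V -> R) x : smooth psi ->
  differentiable (fun y => psi (rho y *: th)) x /\
  forall i, partial i (fun y => psi (rho y *: th)) x =
    (\sum_(j < n) th 0 j * partial j psi (rho x *: th)) * (x 0 i * (rho x)^-1).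
Proof.
move=> spsi; have [drho prho] := diff_smooth_norm x.
have d : is_derive (rho x) 1 (fun s : R => psi (s *: th)) ('D_th psi (rho x *: th)).
  have := @is_derive_line R n psi 0 th (rho x).
  rewrite add0r => /(_ (smooth_differentiable _ spsi)).
  by under eq_fun do rewrite add0r.
split=> [|i]; first exact: (chain_rule 0 drho d).1.
rewrite /partial (chain_rule (e_ i) drho d).2 -/(partial i rho x) prho.
by rewrite deriveE ?diff_partial//; exact: smooth_differentiable.
Qed.

Lemma regular_diff f : regular f ->
  (forall x, differentiable f x) /\ forall i, regular (partial i f).
Proof.
elim=> [c|i||s|{}f g _ [df rf] _ [dg rg]|{}f g rf [df rdf] rg [dg rdg]].
- split=> // i; rewrite (_ : partial i _ = fun=> 0); first exact: regular_cst.
  by apply/funext => x; exact: derive_cst.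
- split=> [x|j]; first exact: differentiable_coord.
  rewrite (_ : partial j _ = fun=> e_ j 0 i); first exact: regular_cst.
  by apply/funext => x; exact: (@derive_val _ _ _ _ _ _ _ (is_derive_coord _ _ _)).
- have rn0 x : rho x != 0 by rewrite gt_eqF// smooth_norm_gt0.
  split=> [x|i].
    by apply: differentiableV => //; exact: (diff_smooth_norm x).1.
  rewrite (_ : partial i _ = fun x =>
      -1 * (x 0 i * ((rho x)^-1 * ((rho x)^-1 * (rho x)^-1)))).
    apply: regular_mul; first exact: regular_cst.
    apply: regular_mul; first exact: regular_coord.
    by do 2 (apply: regular_mul; first exact: regular_inv_norm); exact: regular_inv_norm.
  apply/funext => x; have [dr pr] := diff_smooth_norm x.
  rewrite /partial deriveV//; last exact: diff_derivable.
  rewrite -/(partial i rho x) pr /GRing.scale/=.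
  by move: (rn0 x); move: (rho x) => s s0; field.
- have ss : smooth (foldr (@partial R n) phi s) by elim: s => [|i s]; [|exact: smooth_partial].
  split=> [x|i]; first exact: (diff_profile x ss).1.
  pose psi := foldr (@partial R n) phi s.
  rewrite (_ : partial i _ = fun x =>
    (\sum_(j <- index_enum 'I_n) th 0 j * partial j psi (rho x *: th)) *
    (x 0 i * (rho x)^-1)).
    apply: regular_mul; last first.
      by apply: regular_mul; [exact: regular_coord|exact: regular_inv_norm].
    elim: (index_enum _) => [|j r IH].
      by rewrite (_ : (fun _ => _) = fun=> 0); [exact: regular_cst|
        apply/funext => x; rewrite big_nil].
    rewrite (_ : (fun _ => _) = fun x =>
        th 0 j * foldr (@partial R n) phi (j :: s) (rho x *: th) +
        \sum_(j <- r) th 0 j * partial j psi (rho x *: th)).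
      apply: regular_add => //; apply: regular_mul; first exact: regular_cst.
      exact: regular_profile.
    by apply/funext => x; rewrite big_cons.
  by apply/funext => x; rewrite (diff_profile x ss).2.
- split=> [x|i]; first exact: differentiableD.
  rewrite (_ : partial i _ = fun x => partial i f x + partial i g x).
    exact: regular_add.
  by apply/funext => x; rewrite /partial deriveD//; exact: diff_derivable.
- split=> [x|i]; first exact: differentiableM.
  rewrite (_ : partial i _ = fun x => f x * partial i g x + g x * partial i f x).
    by apply: regular_add; exact: regular_mul.
  by apply/funext => x; rewrite /partial deriveM//; exact: diff_derivable.
Qed.

Lemma regular_smooth f : regular f -> smooth f.
Proof.
move=> rf s; suff /regular_diff[] : regular (foldr (@partial R n) f s) by [].
by elim: s => //= i s /regular_diff[_].
Qed.

Lemma smooth_profile : smooth (fun x => phi (rho x *: th)).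
Proof. exact/regular_smooth/(regular_profile [::]). Qed.

End radial_regularization.

Section profile_approximation.
Context {R : realType} {n : nat}.
Local Notation V := 'rV[R]_n.
Local Notation B := (unit_ball n : set V).
Implicit Types (phi psi : V -> R) (th : V).

Lemma test_support_radius phi : test_function phi ->
  exists2 r, r < 1 & forall x, phi x != 0 -> enorm x <= r.
Proof.
case=> _ cS SB; set S := closure _ in cS SB.
have sub x : phi x != 0 -> S x by move=> px; exact: subset_closure.
have [S0|/set0P Sn0] := eqVneq S set0.
  by exists 0 => // x /sub; rewrite S0.
have [c Sc cmax] := @EVT_max_rV R n (@enorm R n) S Sn0 cS
  (continuous_subspaceT (@continuous_enorm R n)).
exists (enorm c); first by apply: SB; rewrite inE in Sc.
by move=> x /sub Sx; apply: cmax; rewrite inE.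
Qed.

Lemma test_profile (e : R) phi th : 0 < e -> test_function phi -> enorm th = 1 ->
  test_function (fun x : V => phi (smooth_norm e x *: th)).
Proof.
move=> e0 tphi th1; have [sphi _ _] := tphi.
have [r r1 phir] := test_support_radius tphi.
have cr : closed [set x : V | enorm x <= r].
  have /continuous_closedP := @continuous_enorm R n.
  by move=> /(_ _ (@closed_le R r)).
have sub : closure [set x : V | phi (smooth_norm e x *: th) != 0] `<=` [set x : V | enorm x <= r].
  have /closure_id cl := cr.
  rewrite [X in _ `<=` X]cl; apply: closureS => x /= /phir.
  rewrite enormZ th1 mulr1 gtr0_norm ?smooth_norm_gt0//.
  exact: le_trans (enorm_le_smooth_norm e x).
split; first exact: smooth_profile.
- apply: (subclosed_compact (@closed_closure _ _) (@compact_cube R n r)).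
  move=> x /sub /= xr i /=; rewrite in_itv/= -ler_norml.
  exact: le_trans (coord_le_enorm x i) xr.
- by move=> x /sub /= xr; exact: le_lt_trans xr r1.
Qed.

Definition dotp (a b : V) : R := \sum_(i < n) a 0 i * b 0 i.

Lemma smooth_norm_cvg (x : V) :
  smooth_norm (k.+1%:R^-1) x @[k --> \oo] --> enorm x.
Proof.
have h : \sum_(i < n) x 0 i ^+ 2 + k.+1%:R^-1 ^+ 2 @[k --> \oo] -->
    (\sum_(i < n) x 0 i ^+ 2 : R).
  rewrite -[X in _ --> X]addr0; apply: cvgD; first exact: cvg_cst.
  rewrite [X in _ --> X](_ : 0 = 0 * 0); last by rewrite mulr0.
  by apply: cvgM; exact: cvg_harmonic.
exact: (cvg_comp _ _ h (@sqrt_continuous R _)).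
Qed.

(** The radial function whose profile is the restriction of a test function to a
    ray is in the closure of the test functions. It is only Lipschitz at the
    origin; the smoothed profiles are test functions that converge to it with
    their gradients, boundedly and at every point (at the origin the gradients of
    the smoothed profiles vanish, and dir 0 = 0). *)
Lemma profile_approx phi th d : test_function phi -> enorm th = 1 -> 0 < d ->
  exists2 psi, test_function psi &
    (\int[leb n]_(x in B) (sq_dist (fun x : V => phi (enorm x *: th))
       (fun x => dotp th (gradient phi (enorm x *: th)) *: dir x)
       psi (gradient psi) x)%:E < d%:E)%E.
Proof.
move=> tphi th1 d0; have [sphi _ _] := tphi.
have e0 k : 0 < k.+1%:R^-1 :> R by rewrite invr_gt0.
pose rho k := @smooth_norm R n k.+1%:R^-1.
pose psi k (x : V) := phi (rho k x *: th).
have tpsi k : test_function (psi k) by exact: test_profile.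
pose p r := dotp th (gradient phi (r *: th)).
have gradE k x i : gradient (psi k) x 0 i = p (rho k x) * (x 0 i * (rho k x)^-1).
  rewrite mxE (diff_profile (e0 k) th x sphi).2; congr (_ * _).
  by apply: eq_bigr => j _; rewrite mxE.
have [C1 C10 phiC] := test_bounded tphi.
have [C2 C20 pC] : exists2 C, 0 <= C & forall r, `|p r| <= C.
  have /choice[C CP] j : exists C, 0 <= C /\ forall x, `|partial j phi x| <= C.
    by have [C ? ?] := test_bounded (test_partial j tphi); exists C.
  exists (\sum_(j < n) C j) => [|r]; first by apply: sumr_ge0 => j _; case: (CP j).
  apply: le_trans (ler_norm_sum _ _ _) _; apply: ler_sum => j _.
  rewrite normrM -[leRHS]mul1r mxE ler_pM//; last by case: (CP j).
  by rewrite -th1; exact: coord_le_enorm.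
have cline (f : V -> R) : continuous f -> continuous (fun r : R => f (r *: th)).
  move=> cf r; apply: (@continuous_comp _ _ _ (fun s : R => s *: th) f); last exact: cf.
  exact: scalel_continuous.
have cp : continuous p.
  move=> r; apply: cvg_sumr => j; apply: cvgM; first exact: cvg_cst.
  under eq_fun do rewrite mxE; rewrite mxE; apply: cline.
  exact/smooth_continuous/smooth_partial.
have cvg0 x : sq_dist (fun x : V => phi (enorm x *: th)) (fun x => p (enorm x) *: dir x)
    (psi k) (gradient (psi k)) x @[k --> \oo] --> (0 : R).
  have sq0 (a : R) (b : nat -> R) : b k @[k --> \oo] --> a -> (a - b k) ^+ 2 @[k --> \oo] --> 0.
    move=> ba; rewrite [X in _ --> X](_ : 0 = (a - a) * (a - a)); last by rewrite subrr mulr0.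
    by apply: cvgM; apply: cvgB => //; exact: cvg_cst.
  rewrite -[X in _ --> X](addr0 0); apply: cvgD.
    apply: sq0; have cphi := cline _ (smooth_continuous sphi) (enorm x).
    exact: (cvg_comp _ _ (@smooth_norm_cvg x) cphi).
  have -> : (fun k => enorm (p (enorm x) *: dir x - gradient (psi k) x) ^+ 2) =
      (fun k => \sum_(i < n)
        (p (enorm x) * dir x 0 i - p (rho k x) * (x 0 i * (rho k x)^-1)) ^+ 2).
    apply/funext => k; rewrite sqr_enorm; apply: eq_bigr => i _.
    by rewrite -gradE !mxE.
  rewrite [X in _ --> X](_ : 0 = \sum_(i < n) 0); last by rewrite big1.
  suff H i : (p (enorm x) * dir x 0 i - p (rho k x) * (x 0 i * (rho k x)^-1)) ^+ 2
      @[k --> \oo] --> (0 : R).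
    exact: (cvg_sumr _ H).
  apply: sq0; apply: cvgM.
    exact: (cvg_comp _ _ (@smooth_norm_cvg x) (cp (enorm x))).
  have [->|x0] := eqVneq x 0.
    by rewrite /dir scaler0 mxE; under eq_fun do rewrite mul0r; exact: cvg_cst.
  rewrite mxE mulrC; apply: cvgM; first exact: cvg_cst.
  apply: cvgV; last exact: smooth_norm_cvg.
  by apply: contra_neq x0; exact: enorm_eq0.
have bound k x : sq_dist (fun x : V => phi (enorm x *: th)) (fun x => p (enorm x) *: dir x)
    (psi k) (gradient (psi k)) x <= (2 * C1) ^+ 2 + n%:R * (2 * C2) ^+ 2.
  have sqB (a b M : R) : `|a| <= M -> `|b| <= M -> (a - b) ^+ 2 <= (2 * M) ^+ 2.
    move=> aC bC; rewrite -real_normK ?num_real// ler_sqr ?nnegrE//.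
      by rewrite mulr2n mulrDl mul1r (le_trans (ler_normB _ _))// lerD.
    by rewrite mulr_ge0// (le_trans (normr_ge0 a)).
  apply: lerD; first by apply: sqB; exact: phiC.
  rewrite sqr_enorm mulr_natl -[X in _ *+ X]card_ord -sumr_const.
  apply: ler_sum => i _.
  have -> : (p (enorm x) *: dir x - gradient (psi k) x) 0 i =
      p (enorm x) * dir x 0 i - p (rho k x) * (x 0 i * (rho k x)^-1).
    by rewrite -gradE !mxE.
  apply: sqB.
    rewrite normrM -[leRHS]mulr1 ler_pM//.
    exact: le_trans (coord_le_enorm _ _) (enorm_dir_le1 _).
  rewrite normrM -[leRHS]mulr1 ler_pM// normrM normfV.
  rewrite ler_pdivrMr ?normr_gt0 ?gt_eqF ?smooth_norm_gt0// mul1r.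
  rewrite [leRHS]gtr0_norm ?smooth_norm_gt0//.
  exact: le_trans (coord_le_enorm x i) (enorm_le_smooth_norm _ x).
have mf k : measurable_fun B (fun x =>
    sq_dist (fun x : V => phi (enorm x *: th)) (fun x => p (enorm x) *: dir x)
    (psi k) (gradient (psi k)) x).
  apply: measurable_sq_dist; first exact: measurable_unit_ball.
  - apply: measurable_funTS; apply: measurableT_comp (test_measurable tphi) _.
    apply: measurable_row_fun => // i; under eq_fun do rewrite mxE.
    by apply: measurable_funM => //; exact: measurable_enorm.
  - by apply: measurable_funTS; exact: test_measurable.
  - move=> i; under eq_fun do rewrite mxE; apply: measurable_funM.
      apply: measurable_funTS; apply: measurableT_comp measurable_enorm.
      exact: continuous_measurable_fun.
    apply: measurable_funTS; exact: measurableT_comp (measurable_coord i) measurable_dir.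
  - by move=> i; apply: measurable_funTS; exact: measurable_gradient.
have [||||| _ _ cvgI] := @dominated_convergence _ _ _ (leb n) B measurable_unit_ball
  (fun k x => (sq_dist (fun x : V => phi (enorm x *: th)) (fun x => p (enorm x) *: dir x)
    (psi k) (gradient (psi k)) x)%:E) (fun=> 0%E)
  (fun=> ((2 * C1) ^+ 2 + n%:R * (2 * C2) ^+ 2)%:E).
- by move=> k; exact/measurable_EFinP.
- exact: measurable_cst.
- by apply: aeW => x _; apply: cvg_EFin; [near=> k|exact: cvg0].
- exact: integrable_ball_cst.
- by apply: aeW => x k _; rewrite abse_EFin lee_fin ger0_norm ?sq_dist_ge0.
rewrite integral0 in cvgI.
have : \forall k \near \oo, (\int[leb n]_(x in B) (sq_dist (fun x : V => phi (enorm x *: th))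
   (fun x => p (enorm x) *: dir x) (psi k) (gradient (psi k)) x)%:E < d%:E)%E.
  apply: (cvgI [set y | (y < d%:E)%E]); exists d => //= r.
  by rewrite /ball/= sub0r normrN => rd; rewrite lte_fin (le_lt_trans (ler_norm _)).
by case=> k _ /(_ k (leqnn _)) kd; exists (psi k).
Unshelve. all: by end_near.
Qed.

End profile_approximation.

(** * Supporting lines of convex functions *)

Section supporting_line.
Context {R : realType}.

Lemma convex_chord (b : R) (g : R -> R) (s u t : R) :
  convex_function (`[0, b]%classic : set R) g -> 0 <= s <= b -> 0 <= u <= b ->
  0 <= t <= 1 -> g (t * s + (1 - t) * u) <= t * g s + (1 - t) * g u.
Proof.
move=> cg sb ub /andP[t0 t1].
have := cg (Itv01 t0 t1) s u; rewrite !inE/= !in_itv/= => /(_ sb ub).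
by [].
Qed.

(** The slope is the supremum of the slopes of the chords on the left, which are
    below all slopes of chords on the right. At the end point b there may be no
    supporting line, as g may jump there. *)
Lemma supporting_line (b : R) (g : R -> R) (t0 : R) :
  convex_function (`[0, b]%classic : set R) g -> 0 < t0 < b ->
  exists a, forall t, 0 <= t <= b -> g t0 + a * (t - t0) <= g t.
Proof.
move=> cg /andP[t00 t0b].
have slopes s u : 0 <= s -> s < t0 -> t0 < u -> u <= b ->
    (g t0 - g s) / (t0 - s) <= (g u - g t0) / (u - t0).
  move=> s0 st tu ub.
  have us : 0 < u - s by lra.
  have t01 : 0 <= (u - t0) / (u - s) <= 1.
    rewrite divr_ge0 ?ler_pdivrMr//=; lra.
  have sb : 0 <= s <= b by apply/andP; split; lra.
  have ub' : 0 <= u <= b by apply/andP; split; lra.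
  have := convex_chord cg sb ub' t01.
  have -> : 1 - (u - t0) / (u - s) = (t0 - s) / (u - s) by field; rewrite gt_eqF.
  have -> : (u - t0) / (u - s) * s + (t0 - s) / (u - s) * u = t0.
    by field; rewrite gt_eqF.
  have -> : (u - t0) / (u - s) * g s + (t0 - s) / (u - s) * g u =
    ((u - t0) * g s + (t0 - s) * g u) / (u - s) by field; rewrite gt_eqF.
  rewrite ler_pdivlMr// => h.
  rewrite ler_pdivrMr ?subr_gt0// mulrAC ler_pdivlMr ?subr_gt0//.
  move: h; move: (g t0) (g s) (g u) => x y z h; nra.
pose S := [set (g t0 - g s) / (t0 - s) | s in `[0, t0[%classic].
have Sub u : t0 < u -> u <= b -> ubound S ((g u - g t0) / (u - t0)).
  move=> tu ub _ [s /= + <-]; rewrite in_itv/= => /andP[s0 st].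
  exact: slopes.
have S0 : S !=set0 by exists ((g t0 - g 0) / (t0 - 0)); exists 0 => //=; rewrite in_itv/= lexx.
have hS : has_sup S by split=> //; exists ((g b - g t0) / (b - t0)); exact: Sub.
exists (sup S) => t /andP[t_ge0 tb].
have [tt0|tt0|->] := ltgtP t t0; last by rewrite subrr mulr0 addr0.
  have : (g t0 - g t) / (t0 - t) <= sup S.
    apply: ub_le_sup; first by case: hS.
    by exists t => //=; rewrite in_itv/= t_ge0.
  rewrite ler_pdivrMr ?subr_gt0//; lra.
have : sup S <= (g t - g t0) / (t - t0) by apply: ge_sup => //; exact: Sub.
rewrite ler_pdivlMr ?subr_gt0//; lra.
Qed.

End supporting_line.

(** * Radial functions attached to the rays *)

Section slices.
Context {R : realType} {n : nat}.
Local Notation V := 'rV[R]_n.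
Local Notation B := (unit_ball n : set V).
Implicit Types (w f : V -> R) (G : V -> V) (x y : V).

Let mB : measurable B := measurable_unit_ball.

Lemma spread_ball x y : B x -> B (enorm x *: dir y).
Proof.
move=> Bx; rewrite /unit_ball/= enormZ ger0_norm ?enorm_ge0//.
by rewrite (le_lt_trans _ Bx)// ler_piMr ?enorm_ge0 ?enorm_dir_le1.
Qed.

Lemma measurable_slice d (T : measurableType d) (F : V -> T) y :
  measurable_fun B F -> measurable_fun B (fun x => F (enorm x *: dir y)).
Proof.
move=> mF; apply: (measurable_comp mB _ mF).
  by move=> _ [x Bx <-]; exact: spread_ball.
apply: measurable_funTS; apply: measurable_scale_row => //.
exact: measurable_enorm.
Qed.

Lemma polar_average_ball (F : V -> \bar R) :
  measurable_fun B F -> (forall x, B x -> 0 <= F x)%E ->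
  measurable_fun B (fun y => \int[leb n]_(x in B) F (enorm x *: dir y)%R)%E /\
  (\int[leb n]_(y in B) \int[leb n]_(x in B) F (enorm x *: dir y)%R =
   leb n B * \int[leb n]_(x in B) F x)%E.
Proof.
move=> mF F0; pose F' := F \_ B.
have mF' : measurable_fun [set: V] F'.
  by apply/(measurable_restrictT F mB).
have F'0 x : (0 <= F' x)%E.
  by rewrite /F' patchE; case: ifPn => // /set_mem; exact: F0.
have E y : (\int[@ball_measure R n]_x F' (enorm x *: dir y)%R =
            \int[leb n]_(x in B) F (enorm x *: dir y)%R)%E.
  rewrite (ge0_integral_ball_measure (F := fun x => F' (enorm x *: dir y)))//; last first.
    apply: measurableT_comp mF' _; apply: measurable_scale_row => //.
    exact: measurable_enorm.
  apply: eq_integral => x /set_mem Bx; rewrite /F' patchE mem_set//.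
  exact: spread_ball.
have [mP eP] := polar_average mF' F'0.
have PE : (fun y => \int[@ball_measure R n]_x F' (enorm x *: dir y)%R)%E =
          (fun y => \int[leb n]_(x in B) F (enorm x *: dir y)%R)%E.
  by apply/funext => y; exact: E.
rewrite PE in mP; split; first exact: measurable_funTS.
move: eP; under eq_integral do rewrite E.
have P0 y : (0 <= \int[leb n]_(x in B) F (enorm x *: dir y)%R)%E.
  by apply: integral_ge0 => x Bx; apply: F0; exact: spread_ball.
rewrite (ge0_integral_ball_measure mP P0).
move=> ->; congr (_ * _)%E; rewrite ge0_integral_ball_measure//.
by apply: eq_integral => x xB; rewrite /F' patchE xB.
Qed.

Lemma dir_dir y : dir (dir y) = dir y.
Proof.
have [->|y0] := eqVneq y 0; first by rewrite /dir !scaler0.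
rewrite {2}/dir dirZ// invr_gt0 lt_neqAle enorm_ge0 andbT eq_sym.
by apply: contra_neq y0; exact: enorm_eq0.
Qed.

Lemma dir_spread x y : x != 0 -> dir (enorm x *: dir y) = dir y.
Proof.
move=> x0; rewrite dirZ ?dir_dir// lt_neqAle enorm_ge0 andbT eq_sym.
by apply: contra_neq x0; exact: enorm_eq0.
Qed.

Lemma enorm_spread x y : y != 0 -> enorm (enorm x *: dir y) = enorm x.
Proof.
by move=> y0; rewrite enormZ enorm_dir// mulr1 ger0_norm// enorm_ge0.
Qed.

(* The inequality of Cauchy and Schwarz for a = dir y, from the square of the
   norm of v - t a with t the inner product of a and v. *)
Lemma dotp_dir_le (y v : V) : dotp (dir y) v ^+ 2 <= enorm v ^+ 2.
Proof.
have h : enorm (dir y) ^+ 2 <= 1 by rewrite expr_le1 ?enorm_ge0 ?enorm_dir_le1.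
move: (dir y) h => a h; set t := dotp a v.
have tE : t = \sum_(i < n) a 0 i * v 0 i by []; clearbody t.
have : 0 <= \sum_(i < n) (v 0 i - t * a 0 i) ^+ 2.
  by apply: sumr_ge0 => i _; exact: sqr_ge0.
have -> : \sum_(i < n) (v 0 i - t * a 0 i) ^+ 2 =
    enorm v ^+ 2 - 2 * t * t + t ^+ 2 * enorm a ^+ 2.
  have -> : 2 * t * t = \sum_(i < n) 2 * t * (a 0 i * v 0 i) by rewrite -mulr_sumr -tE.
  rewrite !sqr_enorm mulr_sumr -sumrB -big_split/=.
  by apply: eq_bigr => i _; ring.
move: (enorm v ^+ 2) (enorm a ^+ 2) h => p q h.
have := sqr_ge0 t; nra.
Qed.

(** The radial function that agrees with w on the ray through y. *)
Definition slice w y (x : V) : R := w (enorm x *: dir y).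

(** The gradient of this slice, by the chain rule, when G is the gradient of w. *)
Definition slice_grad G y (x : V) : V :=
  dotp (dir y) (G (enorm x *: dir y)) *: dir x.

Definition radial_sq G (z : V) : R := dotp (dir z) (G z) ^+ 2.

Lemma enorm_slice_grad G y x :
  enorm (slice_grad G y x) ^+ 2 <= radial_sq G (enorm x *: dir y).
Proof.
have [->|x0] := eqVneq x 0.
  by rewrite /slice_grad /dir !scaler0 enorm0 expr0n/= sqr_ge0.
rewrite /radial_sq dir_spread// enormZ enorm_dir// mulr1 real_normK//.
exact: num_real.
Qed.

Lemma measurable_radial_sq G : (forall i, measurable_fun B (fun x => G x 0 i)) ->
  measurable_fun B (radial_sq G).
Proof.
move=> mG; apply: measurable_funX; apply: measurable_sum => i.
apply: measurable_funM => //; apply: measurable_funTS.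
exact: measurableT_comp (measurable_coord i) measurable_dir.
Qed.

End slices.

(** * Almost every slice is in H^1_0 *)

Section slices_H10.
Context {R : realType} {n : nat}.
Local Notation V := 'rV[R]_n.
Local Notation B := (unit_ball n : set V).

Let mB : measurable B := measurable_unit_ball.

Lemma measurable_slice_grad (G : V -> V) (y : V) i :
  (forall j, measurable_fun B (fun x => G x 0 j)) ->
  measurable_fun B (fun x => slice_grad G y x 0 i).
Proof.
move=> mG; under eq_fun do rewrite mxE; apply: measurable_funM.
  apply: (@measurable_slice _ _ _ _ (fun z => dotp (dir y) (G z)) y).
  by apply: measurable_sum => j; apply: measurable_funM.
apply: measurable_funTS; exact: measurableT_comp (measurable_coord i) measurable_dir.
Qed.

Lemma sq_dist_slice_grad (w phi : V -> R) (G H : V -> V) (x y : V) :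
  sq_dist (slice w y) (slice_grad G y) (slice phi y) (slice_grad H y) x <=
  (w (enorm x *: dir y) - phi (enorm x *: dir y)) ^+ 2 +
    radial_sq (fun z => G z - H z) (enorm x *: dir y).
Proof.
rewrite lerD2l (le_trans _ (enorm_slice_grad _ _ _))// le_eqVlt; apply/orP; left.
apply/eqP; congr (enorm _ ^+ 2); rewrite /slice_grad -scalerBl; congr (_ *: _).
rewrite /dotp -sumrB; apply: eq_bigr => i _.
by rewrite !mxE mulrBr.
Qed.

Lemma sq_dist_triangle (u v w : V -> R) (G H K : V -> V) (x : V) :
  sq_dist u G w K x <= 2 * sq_dist u G v H x + 2 * sq_dist v H w K x.
Proof.
have sq (a b c : R) : (a - c) ^+ 2 <= 2 * (a - b) ^+ 2 + 2 * (b - c) ^+ 2.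
  have := sqr_ge0 ((a - b) - (b - c)); nra.
rewrite /sq_dist !mulrDr addrACA lerD// !sqr_enorm !mulr_sumr -big_split/=.
by apply: ler_sum => i _; rewrite !mxE.
Qed.

(** Let phi_k be test functions converging to w. In polar coordinates, the mean
    over y of the squared distance between the slices of w and phi_k along y is
    at most the squared distance between w and phi_k, which tends to 0. So the
    infimum over k of the former vanishes for almost every y, and for such a y
    the slice of w is a limit of slices of test functions, which are themselves
    limits of test functions. *)
Lemma ae_slice_H10 (w : V -> R) (G : V -> V) : H10_grad w G ->
  {ae leb n, forall y, B y -> y != 0 -> H10_grad (slice w y) (slice_grad G y)}.
Proof.
move=> [[[mw _] sG _] [phi [tphi cvphi]]].
have mG i : measurable_fun B (fun x => G x 0 i) by case: (sG i).
have mphi k : measurable_fun B (phi k).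
  by apply: measurable_funTS; exact: test_measurable.
have mdphi k i : measurable_fun B (fun x => gradient (phi k) x 0 i).
  by apply: measurable_funTS; exact: measurable_gradient.
pose F k (z : V) : \bar R :=
  ((w z - phi k z) ^+ 2 + radial_sq (fun x => G x - gradient (phi k) x) z)%:E.
have F0 k x : B x -> (0 <= F k x)%E.
  by move=> _; rewrite lee_fin addr_ge0 ?sqr_ge0.
have mF k : measurable_fun B (F k).
  apply/measurable_EFinP; apply: measurable_funD.
    by apply: measurable_funX; exact: measurable_funB.
  apply: measurable_radial_sq => i.
  have -> : (fun x => (G x - gradient (phi k) x) 0 i) =
      (fun x => G x 0 i - gradient (phi k) x 0 i).
    by apply/funext => x; rewrite !mxE.
  exact: measurable_funB.
pose D k y := (\int[leb n]_(x in B) F k (enorm x *: dir y)%R)%E.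
have mD k : measurable_fun B (D k) := (polar_average_ball (mF k) (F0 k)).1.
have eD k : (\int[leb n]_(y in B) D k y = leb n B * \int[leb n]_(x in B) F k x)%E :=
  (polar_average_ball (mF k) (F0 k)).2.
have D0 k y : (0 <= D k y)%E.
  by apply: integral_ge0 => x Bx; apply: F0; exact: spread_ball.
pose I y := einfs (D ^~ y) 0.
have mI : measurable_fun B I by exact: measurable_fun_einfs.
have ID k y : (I y <= D k y)%E.
  by apply: ereal_inf_lbound; exists k.
have I0 y : (0 <= I y)%E.
  by apply: le_ereal_inf_tmp => _ [k _ <-].
have fB : leb n B \is a fin_num := leb_ball_fin_num.
have intI : (\int[leb n]_(y in B) I y = 0)%E.
  apply/eqP; rewrite eq_le integral_ge0// andbT.
  have bound k : (\int[leb n]_(y in B) I y <= leb n B * \int[leb n]_(x in B)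
      ((w x - phi k x) ^+ 2 + enorm (G x - gradient (phi k) x) ^+ 2)%:E)%E.
    apply: le_trans (_ : \int[leb n]_(y in B) D k y <= _)%E.
      by apply: ge0_le_integral.
    rewrite eD; apply: lee_pmul => //; first by apply: integral_ge0 => x; exact: F0.
    apply: ge0_le_integral => //; first exact: F0.
      by apply/measurable_EFinP; apply: measurable_sq_dist.
    by move=> x _; rewrite lee_fin lerD2l; exact: dotp_dir_le.
  have cvB := cvgeZl fB cvphi; rewrite mule0 in cvB.
  rewrite -(cvg_lim _ cvB)//; apply: lime_ge; first by apply/cvg_ex; exists 0%E.
  by near=> k; exact: bound.
have /(ae_eq_integral_abs (leb n) mB mI) : (\int[leb n]_(y in B) `|I y| = 0)%E.
  by under eq_integral do rewrite gee0_abs//.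
apply: filterS => y Iy0 By y0.
have {}Iy0 : I y = 0%E by exact: Iy0.
apply: H10_approx => [||e e0].
- exact: measurable_slice.
- by move=> i; exact: measurable_slice_grad.
have e4 : 0 < e / 4 by rewrite divr_gt0.
have Il : (ereal_inf (sdrop (D ^~ y) 0) < (e / 4)%:E)%E.
  by rewrite -[X in (X < _)%E]/(I y) Iy0 lte_fin.
have [_ [k _ <-] Dk] := ereal_inf_lt Il.
have [psi tpsi psie] := profile_approx (tphi k) (enorm_dir y0) e4.
exists psi => //.
have m1 : measurable_fun B (fun x => (F k (enorm x *: dir y))).
  exact: measurable_slice.
have mS : measurable_fun B (fun x => (sq_dist (slice (phi k) y)
    (slice_grad (gradient (phi k)) y) psi (gradient psi) x)%:E).
  apply/measurable_EFinP; apply: measurable_sq_dist => //.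
  - exact: measurable_slice.
  - by apply: measurable_funTS; exact: test_measurable.
  - by move=> i; exact: measurable_slice_grad.
  - by move=> i; apply: measurable_funTS; exact: measurable_gradient.
apply: (@le_lt_trans _ _ (\int[leb n]_(x in B) (2%:E * F k (enorm x *: dir y)%R +
   2%:E * (sq_dist (slice (phi k) y) (slice_grad (gradient (phi k)) y)
             psi (gradient psi) x)%:E))%E).
  apply: ge0_le_integral => //.
  - by move=> x _; rewrite lee_fin sq_dist_ge0.
  - apply/measurable_EFinP; apply: measurable_sq_dist => //.
    + exact: measurable_slice.
    + by apply: measurable_funTS; exact: test_measurable.
    + by move=> i; exact: measurable_slice_grad.
    + by move=> i; apply: measurable_funTS; exact: measurable_gradient.
  - by apply: emeasurable_funD; apply: emeasurable_funM.
  - move=> x _; rewrite -!EFinM -EFinD lee_fin.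
    apply: le_trans (sq_dist_triangle _ (slice (phi k) y) _ _
      (slice_grad (gradient (phi k)) y) _ _) _.
    by rewrite lerD2r ler_pM2l// sq_dist_slice_grad.
rewrite ge0_integralD//; last 4 first.
- by move=> x Bx; rewrite mule_ge0// F0//; exact: spread_ball.
- exact: emeasurable_funM.
- by move=> x _; rewrite mule_ge0// lee_fin sq_dist_ge0.
- exact: emeasurable_funM.
rewrite !ge0_integralZl//; last 2 first.
- by move=> x _; rewrite lee_fin sq_dist_ge0.
- by move=> x Bx; rewrite F0//; exact: spread_ball.
have -> : e%:E = (2%:E * (e / 4)%:E + 2%:E * (e / 4)%:E)%E.
  by rewrite -!EFinM -EFinD; congr EFin; field.
apply: lteD.
- by rewrite lte_pmul2l.
- by rewrite lte_pmul2l.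
Unshelve. all: by end_near.
Qed.

End slices_H10.

(** * Contact sets of the slices *)

Section contact.
Context {R : realType} {n : nat}.
Local Notation V := 'rV[R]_n.
Local Notation B := (unit_ball n : set V).

Let mB : measurable B := measurable_unit_ball.

Lemma measurable_contact (w f : V -> R) :
  measurable_fun B w -> measurable_fun B f -> measurable (contact_set w f).
Proof.
move=> mw mf; rewrite (_ : contact_set w f = B `&` (fun x => w x - f x) @^-1` [set 0]).
  by apply: (measurable_funB mw mf mB); exact: measurable_set1.
apply/seteqP; split=> x /= [Bx].
  by move=> ->; rewrite subrr.
by move=> /subr0_eq.
Qed.

(** The measure of the set of points x such that the point at distance |x| on the
    ray through y is a contact point. In this form it is measurable in y, and its
    mean is the measure of the contact set. *)
Definition slice_contact (w f : V -> R) (y : V) : \bar R :=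
  (\int[leb n]_(x in B) (\1_(contact_set w f) (enorm x *: dir y))%:E)%E.

Lemma measurable_slice_set (N : set V) (y : V) : measurable N ->
  measurable [set x : V | B x /\ N (enorm x *: dir y)].
Proof.
move=> mN; have : measurable_fun B (fun x : V => enorm x *: dir y).
  apply: measurable_funTS; apply: measurable_scale_row => //; exact: measurable_enorm.
by move=> /(_ mB _ mN).
Qed.

Lemma ae_slice_null (N : set V) : measurable N -> leb n N = 0%E ->
  {ae leb n, forall y, B y ->
     leb n [set x : V | B x /\ N (enorm x *: dir y)] = 0%E}.
Proof.
move=> mN N0.
have m1 : measurable_fun B (fun x => (\1_N x)%:E : \bar R).
  by apply/measurable_EFinP.
have p1 (x : V) : B x -> (0 <= (\1_N x)%:E :> \bar R)%E by rewrite lee_fin.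
have [mI eI] := polar_average_ball m1 p1.
have : (\int[leb n]_(y in B) `|\int[leb n]_(x in B) (\1_N (enorm x *: dir y))%:E| = 0)%E.
  under eq_integral do rewrite gee0_abs ?integral_ge0//.
  rewrite eI integral_indic// [X in (_ * X)%E](_ : _ = 0%E) ?mule0//.
  by apply: subset_measure0 N0 => //; exact: measurableI.
move/(ae_eq_integral_abs (leb n) mB mI); apply: filterS => y + By => /(_ By) /=.
move=> <-; have mN' := measurable_slice_set y mN.
rewrite (_ : [set x | _] = [set x : V | B x /\ N (enorm x *: dir y)] `&` B); last first.
  by apply/seteqP; split=> x /= => [[? ?]|[]].
rewrite -integral_indic//; apply: eq_integral => x /set_mem Bx; rewrite !indicE.
congr ((nat_of_bool _)%:R%:E).
by apply/idP/idP; rewrite !inE/=; [case|split].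
Qed.

(** For almost every ray, f agrees almost everywhere with its own slice along the
    ray; this uses that f is radial. *)
Lemma ae_slice_contact (w f : V -> R) :
  measurable_fun B w -> measurable_fun B f -> radial f ->
  {ae leb n, forall y, B y -> y != 0 ->
     leb n (contact_set (slice w y) f) = slice_contact w f y}.
Proof.
move=> mw mf [h [N [mN N0 fN]]].
apply: filterS (ae_slice_null mN N0) => y + By y0 => /(_ By) Ny.
have mK := measurable_contact mw mf.
have mS : measurable (contact_set (slice w y) f).
  by apply: measurable_contact => //; exact: measurable_slice.
rewrite (_ : leb n (contact_set (slice w y) f) =
    \int[leb n]_(x in B) (\1_(contact_set (slice w y) f) x)%:E)%E; last first.
  rewrite integral_indic//; congr (leb n _); apply/esym/setIidPl => x [].
  by [].
have mN' : measurable [set x : V | B x /\ N (enorm x *: dir y)].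
  exact: measurable_slice_set.
apply: ae_eq_integral => //.
- by apply/measurable_EFinP.
- apply/measurable_EFinP; have m1 : measurable_fun B (\1_(contact_set w f) : V -> R).
    by apply: measurable_funTS.
  exact: measurable_slice m1.
exists (N `|` [set x : V | B x /\ N (enorm x *: dir y)]); split.
- exact: measurableU.
- exact: null_set_setU.
move=> x /= /not_implyP[Bx Ex]; apply: contrapT => /not_orP[Nx Nyx]; apply: Ex.
have fx : f x = h (enorm x).
  by apply: contrapT => fx; apply: Nx; apply: fN => /= /(_ Bx).
have fyx : f (enorm x *: dir y) = h (enorm x).
  apply: contrapT => fyx; apply: Nyx; split=> //; apply: fN => /=.
  by move=> /(_ (spread_ball y Bx)); rewrite enorm_spread.
rewrite !indicE; congr ((nat_of_bool _)%:R%:E).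
apply/idP/idP; rewrite !inE /contact_set /slice/= fx fyx => -[_ wf]; split=> //.
exact: spread_ball.
Qed.

End contact.

(** * Choice of a direction *)

Section jensen_selection.
Context {d : measure_display} {T : measurableType d} {R : realType}.
Variables (mu : {measure set T -> \bar R}) (D : set T).
Hypothesis mD : measurable D.
Variables (b e t0 : R) (g : R -> R).
Hypotheses (muD : mu D = b%:E) (t0_gt0 : 0 < t0) (t0b : t0 <= b).
Hypotheses (g_convex : convex_function (`[0, b]%classic : set R) g)
  (g0 : g 0 = 0) (gt0 : 0 < g t0) (e0 : 0 <= e).

Variables (E : T -> \bar R) (m : T -> R).
Hypotheses (mE : measurable_fun D E) (mm : measurable_fun D m).
Hypotheses (E_ge0 : forall y, D y -> (0 <= E y)%E)
  (m_itv : forall y, D y -> 0 <= m y <= b).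
Hypotheses (E_le : (\int[mu]_(y in D) E y <= (b * e)%:E)%E)
  (m_avg : (\int[mu]_(y in D) (m y)%:E = (b * t0)%:E)%E).

Let integrable_cst (c : R) : mu.-integrable D (fun=> c%:E).
Proof.
apply/integrableP; split=> //; rewrite integral_cst//= muD -EFinM; exact: ltry.
Qed.

Let integrable_m : mu.-integrable D (EFin \o m).
Proof.
apply: (le_integrable mD _ _ (integrable_cst b)); first exact/measurable_EFinP.
move=> y Dy /=; have /andP[m0 mb] := m_itv Dy.
by rewrite lee_fin !ger0_norm// (le_trans m0).
Qed.

Let integral_affine (q a c : R) :
  (\int[mu]_(y in D) (q * (c + a * (m y - t0)))%:E = (q * c * b)%:E)%E.
Proof.
have -> : (fun y => (q * (c + a * (m y - t0)))%:E) =
    (fun y => (q * a)%:E * (m y)%:E + (q * (c - a * t0))%:E)%E.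
  by apply/funext => y; rewrite -EFinM -EFinD; congr EFin; ring.
rewrite integralD//; last exact: integrableZl.
rewrite integralZl// m_avg integral_cst// muD -!EFinM -EFinD; congr EFin; ring.
Qed.

Let integrable_affine (q a c : R) :
  mu.-integrable D (fun y => (q * (c + a * (m y - t0)))%:E).
Proof.
have -> : (fun y => (q * (c + a * (m y - t0)))%:E) =
    (fun y => (q * a)%:E * (m y)%:E + (q * (c - a * t0))%:E)%E.
  by apply/funext => y; rewrite -EFinM -EFinD; congr EFin; ring.
by apply: integrableD => //; exact: integrableZl.
Qed.

Let ae_eq0 (h : T -> \bar R) : mu.-integrable D h ->
  {ae mu, forall y, D y -> (0 <= h y)%E} -> (\int[mu]_(y in D) h y <= 0)%E ->
  {ae mu, forall y, D y -> h y = 0%E}.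
Proof.
move=> ih h0 hle; have [mh _] := integrableP _ _ _ ih.
have mah : measurable_fun D (fun y => `|h y|)%E by exact: measurableT_comp.
have : (\int[mu]_(y in D) `|h y| = 0)%E.
  apply/eqP; rewrite eq_le integral_ge0// andbT (le_trans _ hle)//.
  rewrite le_eqVlt; apply/orP; left; apply/eqP; apply: ae_eq_integral => //.
  by apply: filterS h0 => y + Dy => /(_ Dy) /gee0_abs.
by move=> /(ae_eq_integral_abs mu mD mh).
Qed.

(* When t0 = b the mean of m is its maximum, so that m = t0 almost everywhere and
   any slope works. *)
Let ae_support : exists a, {ae mu, forall y, D y -> g t0 + a * (m y - t0) <= g (m y)}.
Proof.
have [t0_ltb|] := ltP t0 b.
  have [|a aP] := @supporting_line R b g t0 g_convex; first by rewrite t0_gt0.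
  by exists a; apply: aeW => y Dy; apply: aP; exact: m_itv.
move=> bt0; have {bt0} bt0 : b = t0 by apply/eqP; rewrite eq_le bt0.
exists 0.
have : {ae mu, forall y, D y -> (b - m y)%:E = 0%E}.
  have bE : (fun y => (b - m y)%:E) = (fun y => (1 * (0 + -1 * (m y - t0)))%:E).
    by apply/funext => y; rewrite bt0; congr EFin; ring.
  apply: ae_eq0.
  - by rewrite bE; exact: integrable_affine.
  - by apply: aeW => y Dy; rewrite lee_fin subr_ge0; case/andP: (m_itv Dy).
  - by rewrite bE integral_affine mulr0 mul0r.
apply: filterS => y + Dy => /(_ Dy) [] /subr0_eq <-.
by rewrite mul0r addr0 bt0.
Qed.

(** Otherwise E > (e / g t0) g(m) wherever m > 0, so that E is almost everywhere
    at least the affine function L of m obtained from a supporting line of g at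
    the mean t0 of m. The mean of L is (e / g t0) g(t0) = e, and the mean of E is
    at most e. So E = L almost everywhere, which forces
    m = 0 almost everywhere, whereas the mean of m is positive. *)
Lemma jensen_selection (P : T -> Prop) : {ae mu, forall y, D y -> P y} ->
  exists y, [/\ D y, P y, 0 < m y & (E y <= (e / g t0 * g (m y))%:E)%E].
Proof.
move=> aeP; apply: contrapT => no.
pose Q := e / g t0.
have Q0 : 0 <= Q by rewrite divr_ge0// ltW.
have lt y : D y -> P y -> 0 < m y -> ((Q * g (m y))%:E < E y)%E.
  by move=> Dy Py my; rewrite ltNge; apply/negP => le; apply: no; exists y.
have [a aP] := ae_support.
pose L y := Q * (g t0 + a * (m y - t0)).
have iL : mu.-integrable D (fun y => (L y)%:E) by exact: integrable_affine.
have eL : (\int[mu]_(y in D) (L y)%:E = (b * e)%:E)%E.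
  by rewrite integral_affine /Q divfK ?gt_eqF// mulrC.
have iE : mu.-integrable D E.
  apply/integrableP; split=> //; rewrite (eq_integral E).
    exact: le_lt_trans E_le (ltry _).
  by move=> y /set_mem Dy; rewrite gee0_abs// E_ge0.
have LE : {ae mu, forall y, D y -> (L y <= Q * g (m y))%R}.
  by apply: filterS aP => y + Dy => /(_ Dy) h; rewrite /L ler_wpM2l.
have hE : {ae mu, forall y, D y -> (E y - (L y)%:E = 0)%E}.
  apply: ae_eq0; first exact: integrableB.
    apply: filterS2 aeP LE => y + + Dy => /(_ Dy) Py /(_ Dy) Ly.
    rewrite sube_ge0//.
    have /andP[m0 mb] := m_itv Dy.
    have [my|my] := ltP 0 (m y).
      by apply: le_trans (ltW (lt _ Dy Py my)); rewrite lee_fin.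
    have m00 : m y = 0 by apply/eqP; rewrite eq_le my.
    by apply: le_trans (E_ge0 Dy); rewrite lee_fin (le_trans Ly)// m00 g0 mulr0.
  by rewrite integralB// eL sube_le0.
have m0 : {ae mu, forall y, D y -> (m y)%:E = 0%E}.
  apply: filterS3 aeP LE hE => y + + + Dy => /(_ Dy) Py /(_ Dy) Ly /(_ Dy) EL.
  have /andP[m0 mb] := m_itv Dy.
  have [my|my] := ltP 0 (m y); last by congr EFin; apply/eqP; rewrite eq_le my.
  have := lt _ Dy Py my; have -> : E y = (L y)%:E.
    by move: EL; case: (E y) => [r| |]// [] /subr0_eq ->.
  by rewrite lte_fin ltNge Ly.
have : (\int[mu]_(y in D) (m y)%:E = 0)%E.
  rewrite (ae_eq_integral (cst 0%E))// ?integral0//.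
  exact/measurable_EFinP.
rewrite m_avg => -[] /eqP; rewrite mulf_eq0 !gt_eqF//.
by rewrite (lt_le_trans t0_gt0).
Qed.

End jensen_selection.

(** * The infimum over radial functions *)

Theorem lemma1p10 (R : realType) (d : nat) (d_gt0 : (0 < d)%N)
    (f : 'rV[R]_d -> R) (g : R -> R)
    (f_radial : radial f) (f_H1 : H1 f)
    (g_ge0 : {in `[0, fine (leb d (unit_ball d))], forall t, 0 <= g t})
    (g_convex :
      convex_function (`[0, fine (leb d (unit_ball d))]%classic : set R) g)
    (g0 : g 0 = 0)
    (g_gt0 : {in `]0, fine (leb d (unit_ball d))], forall t, 0 < g t}) :
  ereal_inf (quotients f g (fun=> True)) = ereal_inf (quotients f g (@radial R d)).
Proof.
apply/eqP; rewrite eq_le; apply/andP; split.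
  apply: le_ereal_inf_tmp => q [w [G [wG _ cw ->]]].
  by apply: ereal_inf_lbound; exists w, G.
apply: le_ereal_inf_tmp => q [w [G [wG _ cw ->]]].
set B := unit_ball d in g_ge0 g_convex g_gt0 *.
have mB : measurable (B : set 'rV[R]_d) := measurable_unit_ball.
have [Gf [[mf _] _ _]] := f_H1.
have [[[mw _] sG _] _] := wG.
have mG i : measurable_fun B (fun x => G x 0 i) by case: (sG i).
have fB : leb d B \is a fin_num := leb_ball_fin_num.
set K := contact_set w f in cw *.
have mK : measurable K by exact: measurable_contact.
have KB : K `<=` B by move=> x [].
have KleB : (leb d K <= leb d B)%E by apply: le_measure => //; rewrite inE.
have fK : leb d K \is a fin_num.
  by rewrite ge0_fin_numE ?measure_ge0// (le_lt_trans KleB)// leb_ball_lty.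
set b := fine (leb d B) in g_ge0 g_convex g_gt0.
have bE : leb d B = b%:E by rewrite fineK.
set t0 := fine (leb d K).
have t0E : leb d K = t0%:E by rewrite fineK.
have t0_gt0 : 0 < t0.
  by rewrite fine_gt0// lt0e cw measure_ge0 -ge0_fin_numE ?measure_ge0.
have t0b : t0 <= b by rewrite -lee_fin -t0E -bE.
have gt0 : 0 < g t0 by apply: g_gt0; rewrite in_itv/= t0_gt0.
have ienergy : (leb d).-integrable B (fun x => (enorm (G x) ^+ 2)%:E).
  have -> : (fun x => (enorm (G x) ^+ 2)%:E) = (fun x => \sum_(i < d) (G x 0 i ^+ 2)%:E)%E.
    by apply/funext => x; rewrite sqr_enorm sumEFin.
  by apply: integrable_sum => // i _; case: (sG i).
set A := (\int[leb d]_(x in B) (enorm (G x) ^+ 2)%:E)%E.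
have fA : A \is a fin_num by exact: integrable_fin_num.
set e := fine A.
have AE : A = e%:E by rewrite fineK.
have e0 : 0 <= e by rewrite fine_ge0// integral_ge0// => x _; rewrite lee_fin sqr_ge0.
(* The energy of almost every slice is bounded by the integral along its ray of
   the squared radial part of G, whose mean is at most the energy of w. *)
have mr : measurable_fun B (fun x => (radial_sq G x)%:E).
  by apply/measurable_EFinP; exact: measurable_radial_sq.
have r0 x : B x -> (0 <= (radial_sq G x)%:E)%E by rewrite lee_fin sqr_ge0.
have [mE eE] := polar_average_ball mr r0.
have mc : measurable_fun B (fun x => (\1_K x)%:E : \bar R) by exact/measurable_EFinP.
have c0 (x : 'rV[R]_d) : B x -> (0 <= (\1_K x)%:E :> \bar R)%E by rewrite lee_fin.
have [mM eM] := polar_average_ball mc c0.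
pose m y := fine (slice_contact w f y).
have M0 y : (0 <= slice_contact w f y)%E.
  by apply: integral_ge0 => x _; rewrite lee_fin.
have Mb y : (slice_contact w f y <= b%:E)%E.
  rewrite -bE -[leRHS]mul1e -integral_cst//; apply: ge0_le_integral => //.
  - exact: measurable_slice mc.
  - by move=> x _; rewrite lee_fin indicE; case: (_ \in _).
have ME y : slice_contact w f y = (m y)%:E.
  by rewrite fineK// ge0_fin_numE// (le_lt_trans (Mb y))// ltry.
have aeP : {ae leb d, forall y, B y -> [/\ y != 0,
    H10_grad (slice w y) (slice_grad G y) &
    leb d (contact_set (slice w y) f) = slice_contact w f y]}.
  have ne0 : {ae leb d, forall y : 'rV[R]_d, y != 0}.
    exists [set 0]; split; [|exact: leb_origin|].
      rewrite (_ : [set 0] = @enorm R d @^-1` [set 0]).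
        by rewrite -[X in measurable X]setTI; exact: measurable_enorm.
      by apply/seteqP; split=> x /= => [->|/enorm_eq0//]; exact: enorm0.
    by move=> y /= /negP/negPn/eqP.
  apply: filterS3 ne0 (ae_slice_H10 wG) (ae_slice_contact mw mf f_radial).
  by move=> y y0 Hy Cy By; split; [|exact: Hy|exact: Cy].
have E0 y : B y ->
    (0 <= \int[leb d]_(x in B) (radial_sq G (enorm x *: dir y))%:E)%E.
  by move=> _; apply: integral_ge0 => x _; rewrite lee_fin sqr_ge0.
have mitv y : B y -> 0 <= m y <= b.
  by move=> _; rewrite -!lee_fin -ME M0 Mb.
have Ele : (\int[leb d]_(y in B) \int[leb d]_(x in B) (radial_sq G (enorm x *: dir y))%:E
    <= (b * e)%:E)%E.
  rewrite eE bE EFinM -AE; apply: lee_pmul => //.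
  - by rewrite lee_fin (le_trans (ltW t0_gt0)).
  - by apply: integral_ge0.
  apply: ge0_le_integral => //; first by case/integrableP: ienergy.
  by move=> x _; rewrite lee_fin dotp_dir_le.
have mavg : (\int[leb d]_(y in B) (m y)%:E = (b * t0)%:E)%E.
  under eq_integral do rewrite -ME.
  rewrite [LHS]eM bE EFinM -t0E integral_indic//; congr (_ * leb d _)%E.
  exact: setIidl.
have mm : measurable_fun B m.
  apply/measurable_EFinP; rewrite (_ : EFin \o m = slice_contact w f)//.
  by apply/funext => y /=; rewrite ME.
have [y [By [y0 Hy Cy] my Ey]] := jensen_selection mB bE t0_gt0 t0b g_convex g0 gt0 e0
  mE mm E0 mitv Ele mavg aeP.
have gm : 0 < g (m y) by apply: g_gt0; rewrite in_itv/= my; case/andP: (mitv _ By).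
apply: (@le_trans _ _ (\int[leb d]_(x in B) (enorm (slice_grad G y x) ^+ 2)%:E /
    (g (m y))%:E)%E).
  apply: ereal_inf_lbound; exists (slice w y), (slice_grad G y); split => //.
  - exists (fun r => w (r *: dir y)); exact: aeW.
  - by rewrite Cy ME eqe gt_eqF.
  - by rewrite Cy.
have mHy : measurable_fun B (fun x => (enorm (slice_grad G y x) ^+ 2)%:E : \bar R).
  apply/measurable_EFinP; apply: measurable_sq_enorm => // i.
  exact: measurable_slice_grad.
rewrite AE !inver !gt_eqF// lee_pdivrMr// -!EFinM; apply: le_trans Ey.
apply: ge0_le_integral => //.
- by move=> x _; rewrite lee_fin sqr_ge0.
- exact: measurable_slice mr.
- by move=> x _; rewrite lee_fin enorm_slice_grad.
Qed.
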